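(* Let $(R,\mathfrak m)$ be a Cohen-Macaulay local ring of dimension $d\ge2$ with infinite residue field, and let $I_1,I_2$ be $\mathfrak m$-primary ideals of $R$. Let $J=(x_1,\dots,x_d)$ be a minimal reduction of $I_2$ generated by a superficial sequence $x_1,\dots,x_d$ for $I_2$ and $I_1$. Suppose $J\subseteq I_1$ and $J\cap I_1I_2=JI_1$. Then: (1) $$f_{0,I_1}(I_2)\le e_1(I_2)-e_0(I_2)+\ell\!\left(\frac{I_2}{I_1I_2}\right)+\ell\!\left(\frac R{I_2}\right)-(d-1)\,\ell\!\left(\frac R{I_1}\right),$$ and equality holds if and only if $G_{I_1}(I_2)$ is Cohen-Macaulay and $I_1I_2^n+J=J$ for all $n\ge2$. (2) $$f_{0,I_1}(I_2)\ge e_1(I_2)-\ell\!\left(\frac{I_1I_2}{JI_1}\right)-\sum_{n\ge2}\ell\!\left(\frac{I_1I_2^n}{JI_1I_2^{n-1}}\right)+\ell\!\left(\frac R{I_1}\right),$$ and equality holds if and only if $\operatorname{depth}G_{I_1}(I_2)\ge d-1$.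
   Context: $\ell$ denotes length. The integers $e_i(I_2)$ are defined by $\ell(R/I_2^n)=\sum_{i=0}^d(-1)^ie_i(I_2)\binom{n+d-1-i}{d-i}$ for $n\gg0$. The integers $f_{i,I_1}(I_2)$ are the Hilbert coefficients of the fiber cone $F_{I_1}(I_2)=\bigoplus_{n\ge0}I_2^n/I_1I_2^n$, defined by $\ell(I_2^n/I_1I_2^n)=\sum_{i=0}^{d-1}(-1)^if_{i,I_1}(I_2)\binom{n+d-1-i}{d-1-i}$ for $n\gg0$; thus $f_{0,I_1}(I_2)$ is the multiplicity of the fiber cone. $G_{I_1}(I_2):=R/I_1\oplus\bigoplus_{n\ge1}I_1I_2^{n-1}/I_1I_2^{n}$, i.e. the associated graded object $\bigoplus_{n\ge0}M_n/M_{n+1}$ of the filtration $M_0=R$, $M_n=I_1I_2^{n-1}$ for $n\ge1$. Since $J\subseteq I_1\cap I_2$, multiplication by $x_i$ maps $M_n/M_{n+1}$ to $M_{n+1}/M_{n+2}$, so $G_{I_1}(I_2)$ is a graded module over $R[X_1,\dots,X_d]$ with $X_i$ acting as this map (the action of the initial form $x_i^\star$). The depth of $G_{I_1}(I_2)$ is the length of a maximal regular sequence on it in the ideal $(X_1,\dots,X_d)$, and it is Cohen-Macaulay when this depth equals $d$. An element $x\in I_2$ is superficial for $I_2$ and $I_1$ if there is a positive integer $r_0$ such that $xR\cap I_1^sI_2^r=xI_1^sI_2^{r-1}$ for all $r\ge r_0$ and all $s\ge0$. A sequence $x_1,\dots,x_d$ in $I_2$ is a superficial sequence for $I_2$ and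 $I_1$ if for each $i$ the image of $x_i$ in $R/(x_1,\dots,x_{i-1})$ is superficial for the images of $I_2$ and $I_1$. *)

(* Defs.v *)
From HB Require Import structures.
From mathcomp Require Import all_boot all_order all_algebra all_classical.
From mathcomp Require mpoly.

Set Implicit Arguments.
Unset Strict Implicit.
Unset Printing Implicit Defensive.

Import Order.TTheory GRing.Theory Num.Theory.

Local Open Scope classical_set_scope.
Local Open Scope ring_scope.

Definition chain (T : Type) (P : set (set T)) (k : nat) : Prop :=
  exists C : nat -> set T,
    (forall i, (i <= k)%N -> P (C i)) /\ (forall i, (i < k)%N -> C i `<` C i.+1).

Definition max_chain (T : Type) (P : set (set T)) (k : nat) : Prop :=
  chain P k /\ forall j, chain P j -> (j <= k)%N.

Section Submodules.
Variables (S : comNzRingType) (V : lmodType S).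
Implicit Types (A : set S) (N L : set V).

Definition submodule N : Prop := GRing.submod_closed [in N].

Definition span (X : set V) : set V := smallest submodule X.

Definition smul A N : set V := span [set a *: v | a in A & v in N].

Definition sadd N L : set V := [set u + v | u in N & v in L].

(* The length of N / L, for submodules L `<=` N of V; by convention it is 0
   if N / L does not have finite length. *)
Definition quot_length N L : nat :=
  xget 0%N [set k | max_chain
    [set C | [/\ submodule C, L `<=` C & C `<=` N]] k].

(* f_1, ..., f_k is a regular sequence on N / L, for submodules L `<=` N
   of V: the submodule (f_1, ..., f_i)(N / L) is represented by its preimage
   (f_1, ..., f_i) N + L in N. *)
Definition regular_seq (fs : seq S) N L : Prop :=
  (forall i, (i < size fs)%N ->
     let Q := sadd (smul [set` take i fs] N) L in
     forall v, N v -> Q (fs`_i *: v) -> Q v) /\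
  sadd (smul [set` fs] N) L <> N.

(* Some maximal regular sequence on N / L in A has length k. *)
Definition has_depth A N L (k : nat) : Prop :=
  exists fs : seq S,
    [/\ [set` fs] `<=` A, regular_seq fs N L,
        (forall f, A f -> ~ regular_seq (rcons fs f) N L) & size fs = k].

End Submodules.

Section Ideals.
Variable R : comNzRingType.
Implicit Types (I J K P m : set R) (x : R).

Definition ideal I : Prop := submodule (I : set R^o).

Definition ideal_of (X : set R) : set R := span (X : set R^o).

Definition idmul I J : set R := smul I (J : set R^o).

Definition idexp I (n : nat) : set R := iter n (idmul I) setT.

Definition idadd I J : set R := sadd (I : set R^o) J.

(* The length of the R-module I / J, for ideals J `<=` I. *)
Definition idlength I J : nat := quot_length (I : set R^o) J.

Definition maximal_ideal m : Prop :=
  [/\ ideal m, m <> setT &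
      forall I, ideal I -> m `<=` I -> I = m \/ I = setT].

Definition prime_ideal P : Prop :=
  [/\ ideal P, P <> setT & forall a b, P (a * b) -> P a \/ P b].

Definition radical I : set R := [set a | exists n, I (a ^+ n)].

Definition primary_ideal I : Prop :=
  [/\ ideal I, I <> setT & forall a b, I (a * b) -> I a \/ radical I b].

Definition noetherian : Prop :=
  forall I, ideal I -> exists s : seq R, I = ideal_of [set` s].

Definition local_ring m : Prop := forall I, maximal_ideal I <-> I = m.

Definition krull_dim (d : nat) : Prop :=
  max_chain [set P : set R | prime_ideal P] d.

Definition cohen_macaulay_local m (d : nat) : Prop :=
  [/\ noetherian, local_ring m, krull_dim d &
      has_depth m (setT : set R^o) [set 0] d].

(* The elements of R / m are the cosets a + m. *)
Definition infinite_residue_field m : Prop :=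
  infinite_set (range (fun a : R => [set a + b | b in m])).

Definition reduction J I : Prop :=
  [/\ ideal J, J `<=` I & exists n, idexp I n.+1 = idmul J (idexp I n)].

Definition minimal_reduction J I : Prop :=
  reduction J I /\ forall K, reduction K I -> K `<=` J -> K = J.

(* The image of x in R / K is superficial for the images of I2 and I1. Ideals of
   R / K are represented by their preimages in R, so the image of an ideal A
   becomes A + K. *)
Definition superficial_mod K I2 I1 x : Prop :=
  idadd I2 K x /\
  exists2 r0 : nat, (0 < r0)%N &
    forall r s : nat, (r0 <= r)%N ->
      idadd (ideal_of [set x]) K
        `&` idadd (idmul (idexp I1 s) (idexp I2 r)) K
      = idadd (idmul (ideal_of [set x])
                     (idmul (idexp I1 s) (idexp I2 r.-1))) K.

Definition superficial_seq I2 I1 (xs : seq R) : Prop :=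
  [set` xs] `<=` I2 /\
  forall i, (i < size xs)%N ->
    superficial_mod (ideal_of [set` take i xs]) I2 I1 xs`_i.

(* e 0, ..., e d are the Hilbert coefficients of I. *)
Definition hilbert_coefficients (d : nat) I (e : nat -> int) : Prop :=
  exists n0 : nat, forall n, (n0 <= n)%N ->
    (idlength setT (idexp I n))%:Z =
    \sum_(i < d.+1) (-1) ^+ i * e i * ('C(n + d - 1 - i, d - i))%:Z.

(* f 0, ..., f (d - 1) are the Hilbert coefficients of the fiber cone. *)
Definition fiber_coefficients (d : nat) I1 I2 (f : nat -> int) : Prop :=
  exists n0 : nat, forall n, (n0 <= n)%N ->
    (idlength (idexp I2 n) (idmul I1 (idexp I2 n)))%:Z =
    \sum_(i < d) (-1) ^+ i * f i * ('C(n + d - 1 - i, d - 1 - i))%:Z.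

End Ideals.

(* Imported only here: the notations of mpoly break [in A]. *)
Import mpoly.

(* R[t] as a module over R[X_1, ..., X_d], with X_i acting as multiplication
   by x_i t. *)
Definition shift_module (R : comNzRingType) (d : nat) (x : d.-tuple R) : Type :=
  {poly R}.

Section ShiftModule.
Variables (R : comNzRingType) (d : nat) (x : d.-tuple R).

HB.instance Definition _ := GRing.Zmodule.on (shift_module x).

Definition shift_eval (p : {mpoly R[d]}) : {poly R} :=
  mmap polyC (fun i => tnth x i *: 'X) p.

Definition shift_scale (p : {mpoly R[d]}) (v : shift_module x) :
  shift_module x := shift_eval p * (v : {poly R}).

Fact shift_scaleA p q v :
  shift_scale p (shift_scale q v) = shift_scale (p * q) v.
Proof. by rewrite /shift_scale /shift_eval rmorphM mulrA. Qed.

Fact shift_scale1 : left_id 1 shift_scale.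
Proof. by move=> v; rewrite /shift_scale /shift_eval rmorph1 mul1r. Qed.

Fact shift_scaleDr : right_distributive shift_scale +%R.
Proof. by move=> p u v; rewrite /shift_scale -mulrDr. Qed.

Fact shift_scaleDl v : {morph shift_scale^~ v : p q / p + q}.
Proof. by move=> p q; rewrite /shift_scale /shift_eval rmorphD mulrDl. Qed.

HB.instance Definition _ :=
  GRing.Zmodule_isLmodule.Build {mpoly R[d]} (shift_module x)
    shift_scaleA shift_scale1 shift_scaleDr shift_scaleDl.

End ShiftModule.

Section AssociatedGraded.
Variables (R : comNzRingType) (I1 I2 : set R) (d : nat) (x : d.-tuple R).

Definition filtration (n : nat) : set R :=
  if n is n'.+1 then idmul I1 (idexp I2 n') else setT.

(* The direct sums of the M_n t^n and of the M_{n+1} t^n in R[t], where M is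
   the filtration; the quotient of the first one by the second one is the
   direct sum of the M_n / M_{n+1}, with X_i acting as multiplication by x_i
   from M_n / M_{n+1} to M_{n+1} / M_{n+2}. Both are submodules if every x_i
   is in I1 and I2. *)
Definition graded_num : set (shift_module x) :=
  [set p | forall n, filtration n (p : {poly R})`_n].

Definition graded_den : set (shift_module x) :=
  [set p | forall n, filtration n.+1 (p : {poly R})`_n].

(* The ideal (X_1, ..., X_d) of R[X_1, ..., X_d]. *)
Definition var_ideal : set {mpoly R[d]} := ideal_of (range (fun i => 'X_i)).

Definition graded_depth (k : nat) : Prop :=
  has_depth var_ideal graded_num graded_den k.

Definition graded_cohen_macaulay : Prop := graded_depth d.

End AssociatedGraded.

(* Main.v *)
Require Import Defs.
From mathcomp Require Import all_boot all_order all_algebra all_classical.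
From mathcomp Require Import zify ring.
From mathcomp Require mpoly.

Set Implicit Arguments.
Unset Strict Implicit.
Unset Printing Implicit Defensive.

Import GRing.Theory Num.Theory.

Local Open Scope classical_set_scope.
Local Open Scope ring_scope.

(* Put M_0 = R, M_n = I1 I2^(n-1), and write J = (x_1, ..., x_d),
   K = (x_1, ..., x_(d-1)).  Since l(R/M_(n+1)) is the sum of l(R/I2^n) and
   l(I2^n/I1 I2^n), the first Hilbert coefficient of the filtration M is
   e_0 + e_1 - f_0.  The sequence x is regular, because J is m-primary and R is
   Cohen-Macaulay, so going modulo a superficial element x_i differentiates the
   Hilbert function; after d - 1 steps one is in dimension one, where
   e_0 = l(R/J) and the first coefficient is the sum of the lengths v_n of
   M_n / (x_d M_(n-1) + K cap M_n).  As
     J M_(n-1) <= x_d M_(n-1) + K cap M_n <= J cap M_n,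
   v_n lies between u_n = l(M_n / J cap M_n) and w_n = l(M_n / J M_(n-1)); with
   l(J / J I1) = d l(R/I1) these are the two inequalities.  Equality with all
   u_n says that x_d has a regular initial form modulo K, and the Sally machine
   lifts this to G(M) being Cohen-Macaulay; equality with all w_n forces
   K cap M_n = K M_(n-1), which by Valabrega-Valla and the Sally machine means
   depth G(M) >= d - 1. *)

(** The definition of depth provides only some regular sequence: an unknown [ys] in m for the
    Cohen-Macaulay hypothesis, an unknown and possibly inhomogeneous sequence in (X_1, ..., X_d) for
    G(M). What the argument needs is regularity of the given x_i and of the X_i. The Koszul complex
    makes the transfer: a regular sequence of length k with powers in (x) forces exactness below
    degree k. Recovering regularity of the x_i from exactness takes Nakayama over R; for G(M), whose
    base ring is not local, superficiality in large degrees and a descending induction on the degree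
    take its place.

    The bounds meet in low degree: J M_0 = J and J cap I1 I2 = J I1 give v_1 = w_1 and v_2 = w_2. So
    these two terms are known exactly, the upper bound comes from v_n >= 0 for n >= 3 alone, and the
    sum in the lower bound accounts for the same n.

    Quotients are never formed: N / L is a pair of submodules, and an ideal of R / K is an ideal of
    R containing K. *)

(** * Submodules and their sums *)

Section Submodules.
Variables (S : comNzRingType) (V : lmodType S).
Implicit Types (N L P : set V) (A : set S).

Lemma submoduleP N :
  submodule N <-> N 0 /\ forall a u v, N u -> N v -> N (a *: u + v).
Proof.
split=> [[N0 Nl]|[N0 Nl]]; split.
- by rewrite -in_setE.
- by move=> a u v Nu Nv; rewrite -in_setE; apply: Nl; rewrite in_setE.
- by rewrite in_setE.
- by move=> a u v; rewrite !in_setE; apply: Nl.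
Qed.

Lemma submod0 N : submodule N -> N 0.
Proof. by move/submoduleP=> []. Qed.

Lemma submodZ N a u : submodule N -> N u -> N (a *: u).
Proof.
by move=> /submoduleP[N0 Nl] Nu; rewrite -[a *: u]addr0; apply: Nl.
Qed.

Lemma submodD N u v : submodule N -> N u -> N v -> N (u + v).
Proof. by move=> /submoduleP[N0 Nl] Nu Nv; rewrite -[u]scale1r; apply: Nl. Qed.

Lemma submodN N u : submodule N -> N u -> N (- u).
Proof. by move=> hN Nu; rewrite -scaleN1r; apply: submodZ. Qed.

Lemma submodB N u v : submodule N -> N u -> N v -> N (u - v).
Proof. by move=> hN Nu Nv; apply: submodD => //; apply: submodN. Qed.

Lemma submodP N : N 0 -> (forall u v, N u -> N v -> N (u + v)) ->
  (forall a u, N u -> N (a *: u)) -> submodule N.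
Proof. by move=> N0 ND NZ; apply/submoduleP; split=> // a u v /NZ/ND; apply. Qed.

Lemma submod_sum N (I : Type) (r : seq I) (F : I -> V) :
  submodule N -> (forall i, N (F i)) -> N (\sum_(i <- r) F i).
Proof.
move=> hN NF; elim: r => [|i r IH]; first by rewrite big_nil; apply: submod0.
by rewrite big_cons; apply: submodD.
Qed.

Lemma submodT : submodule (setT : set V).
Proof. exact: submodP. Qed.

Lemma submod_set0 : submodule ([set 0] : set V).
Proof.
by apply: submodP => [//|u v -> ->|a u ->]; rewrite /= ?addr0 ?scaler0.
Qed.

Lemma submodI N L : submodule N -> submodule L -> submodule (N `&` L).
Proof.
move=> hN hL; apply: submodP.
- by split; apply: submod0.
- by move=> u v [? ?] [? ?]; split; apply: submodD.
- by move=> a u [? ?]; split; apply: submodZ.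
Qed.

Lemma submod_span (X : set V) : submodule (Defs.span X).
Proof.
apply: submodP.
- by move=> N [hN _]; apply: submod0.
- by move=> u v hu hv N hN; apply: submodD; [case: hN|apply: hu|apply: hv].
- by move=> a u hu N hN; apply: submodZ; [case: hN|apply: hu].
Qed.

Lemma span_min (X N : set V) : submodule N -> X `<=` N -> Defs.span X `<=` N.
Proof. exact: smallest_sub. Qed.

Lemma generators_span (X : set V) : X `<=` Defs.span X.
Proof. exact: sub_gen_smallest. Qed.

Lemma submod_smul A N : submodule (smul A N).
Proof. exact: submod_span. Qed.

Lemma mem_smul A N a v : A a -> N v -> smul A N (a *: v).
Proof. by move=> Aa Nv; apply: generators_span; exists a => //; exists v. Qed.

Lemma smul_sub A N L : submodule L ->
  (forall a v, A a -> N v -> L (a *: v)) -> smul A N `<=` L.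
Proof. by move=> hL h; apply: span_min => // _ [a Aa] [v Nv] <-; apply: h. Qed.

Lemma submod_sadd N L : submodule N -> submodule L -> submodule (sadd N L).
Proof.
move=> hN hL; apply: submodP.
- by exists 0; [apply: submod0|exists 0; [apply: submod0|rewrite addr0]].
- move=> _ _ [u Nu [v Lv <-]] [u' Nu' [v' Lv' <-]].
  exists (u + u'); first exact: submodD.
  by exists (v + v'); [apply: submodD|rewrite addrACA].
- move=> a _ [u Nu [v Lv <-]]; exists (a *: u); first exact: submodZ.
  by exists (a *: v); [apply: submodZ|rewrite scalerDr].
Qed.

Lemma sadd_subl N L : submodule L -> N `<=` sadd N L.
Proof.
by move=> hL u Nu; exists u => //; exists 0; [apply: submod0|rewrite addr0].
Qed.

Lemma sadd_subr N L : submodule N -> L `<=` sadd N L.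
Proof.
by move=> hN u Lu; exists 0; [apply: submod0|exists u => //; rewrite add0r].
Qed.

Lemma sadd_sub N L P : submodule P -> N `<=` P -> L `<=` P -> sadd N L `<=` P.
Proof.
by move=> hP NP LP _ [u /NP Pu [v /LP Pv <-]]; apply: submodD.
Qed.

Lemma sadd_idr N L : submodule N -> submodule L -> L `<=` N -> sadd N L = N.
Proof.
by move=> hN hL LN; rewrite eqEsubset; split;
  [apply: sadd_sub|apply: sadd_subl].
Qed.

Lemma sadd_mono N N' L L' : N `<=` N' -> L `<=` L' -> sadd N L `<=` sadd N' L'.
Proof. by move=> h h' _ [u /h Nu [v /h' Lv <-]]; exists u => //; exists v. Qed.

End Submodules.

(** * Chains of sets *)

Section Chains.
Variable T : Type.
Implicit Types (P Q : set (set T)).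

Lemma max_chain_ex P k : chain P 0 -> (forall j, chain P j -> (j <= k)%N) ->
  exists k', max_chain P k'.
Proof.
move=> P0 Pk.
have ex : exists n, `[< chain P n >] by exists 0%N; apply/asboolP.
have ub n : `[< chain P n >] -> (n <= k)%N by move/asboolP; apply: Pk.
case: (ex_maxnP ex ub) => k' /asboolP Pk' max; exists k'; split=> // j Pj.
by apply: max; apply/asboolP.
Qed.

Lemma max_chain_inj P j k : max_chain P j -> max_chain P k -> j = k.
Proof. by move=> [Pj maxj] [Pk maxk]; apply/eqP; rewrite eqn_leq maxj ?maxk. Qed.

(** Repetitions in a weakly increasing sequence can be deleted; the sum counts the strict steps that
    remain. *)
Lemma chain_weak P k (D : nat -> set T) :
  (forall i, (i <= k)%N -> P (D i)) ->
  (forall i, (i < k)%N -> D i `<=` D i.+1) ->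
  chain P (\sum_(i < k) `[< ~ D i.+1 `<=` D i >]).
Proof.
move=> PD DD.
(* The induction must remember that the chain ends at [D k], so that [D k.+1] can be appended. *)
suff [C [PC CC Ck]] : exists C : nat -> set T,
    [/\ forall i, (i <= \sum_(i < k) `[< ~ D i.+1 `<=` D i >])%N -> P (C i),
        forall i, (i < \sum_(i < k) `[< ~ D i.+1 `<=` D i >])%N ->
          C i `<` C i.+1
      & C (\sum_(i < k) `[< ~ D i.+1 `<=` D i >])%N = D k] by exists C.
elim: k PD DD => [|k IH] PD DD.
  rewrite big_ord0; exists (fun=> D 0%N); split=> // i _; exact: PD.
have [||C [PC CC Ck]] := IH.
- by move=> i ik; apply: PD; lia.
- by move=> i ik; apply: DD; lia.
rewrite big_ord_recr /=; set s := (\sum_(i < k) _)%N in PC CC Ck *.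
have [h|h] := pselect (D k.+1 `<=` D k).
  have -> : `[< ~ D k.+1 `<=` D k >] = false by apply/asboolPn => /(_ h).
  rewrite addn0; exists C; split=> //; rewrite Ck eqEsubset; split=> //.
  exact: DD.
have -> : `[< ~ D k.+1 `<=` D k >] = true by apply/asboolP.
rewrite addn1; exists (fun i => if (i <= s)%N then C i else D k.+1); split.
- by move=> i _; case: ifP => [/PC //|_]; apply: PD.
- move=> i; rewrite ltnS => his; case: (ltnP i s) => [lt_is|ge_is].
    by rewrite his; apply: CC.
  have -> : i = s by lia.
  by rewrite leqnn Ck; split=> //; apply: DD.
- by rewrite ltnn.
Qed.

End Chains.

Lemma chain_mono (T U : Type) (P : set (set T)) (Q : set (set U))
    (phi : set T -> set U) k :
  (forall C, P C -> Q (phi C)) ->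
  (forall C D, P C -> P D -> C `<` D -> phi C `<` phi D) ->
  chain P k -> chain Q k.
Proof.
move=> PQ mono [C [PC CC]]; exists (phi \o C); split=> i ik /=.
  by apply: PQ; apply: PC.
by apply: mono; [apply: PC; lia|apply: PC|apply: CC].
Qed.

(** Length depends only on the ordered set of intermediate submodules, so mutually inverse monotone
    maps between these sets replace an isomorphism of quotients. *)
Lemma quot_length_iso (S S' : comNzRingType) (V : lmodType S) (W : lmodType S')
    (N L : set V) (N' L' : set W) (phi : set V -> set W) (psi : set W -> set V) :
  (forall C, submodule C -> L `<=` C -> C `<=` N ->
     [/\ submodule (phi C), L' `<=` phi C & phi C `<=` N']) ->
  (forall C, submodule C -> L' `<=` C -> C `<=` N' ->
     [/\ submodule (psi C), L `<=` psi C & psi C `<=` N]) ->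
  (forall C D, C `<=` D -> phi C `<=` phi D) ->
  (forall C D, C `<=` D -> psi C `<=` psi D) ->
  (forall C, submodule C -> L `<=` C -> C `<=` N -> psi (phi C) = C) ->
  (forall C, submodule C -> L' `<=` C -> C `<=` N' -> phi (psi C) = C) ->
  forall k,
  max_chain [set C | [/\ submodule C, L `<=` C & C `<=` N]] k <->
  max_chain [set C | [/\ submodule C, L' `<=` C & C `<=` N']] k.
Proof.
move=> hphi hpsi mphi mpsi phiK psiK.
have E k : chain [set C | [/\ submodule C, L `<=` C & C `<=` N]] k <->
  chain [set C | [/\ submodule C, L' `<=` C & C `<=` N']] k.
  split; [apply: (chain_mono (phi := phi))|apply: (chain_mono (phi := psi))].
  - by move=> C [? ? ?]; apply: hphi.
  - move=> C D [? ? ?] [? ? ?] [CD DC]; split; first exact: mphi.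
    by move=> /mpsi; rewrite !phiK.
  - by move=> C [? ? ?]; apply: hpsi.
  - move=> C D [? ? ?] [? ? ?] [CD DC]; split; first exact: mpsi.
    by move=> /mphi; rewrite !psiK.
by move=> k; split=> -[/E ck mk]; split=> // j /E /mk.
Qed.

(** * Additivity of length *)

Section Length.
Variables (S : comNzRingType) (V : lmodType S).
Implicit Types (N L P : set V).

Definition subint N L : set (set V) := [set C | [/\ submodule C, L `<=` C & C `<=` N]].

(** Guards every use of [quot_length], whose default value 0 would otherwise be taken for a
    length. *)
Definition finlen N L := exists k, max_chain (subint N L) k.

Lemma quot_lengthE N L k : max_chain (subint N L) k -> quot_length N L = k.
Proof.
move=> h; rewrite /quot_length; case: xgetP => [j _ hj|/(_ k)//].
exact: max_chain_inj hj h.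
Qed.

Lemma finlenP N L : finlen N L -> max_chain (subint N L) (quot_length N L).
Proof. by move=> [k hk]; rewrite (quot_lengthE hk). Qed.

Lemma subint_chain0 N L : submodule L -> L `<=` N -> chain (subint N L) 0.
Proof.
by move=> hL LN; exists (fun=> L); split=> // i _; split=> //; exact: subset_refl.
Qed.

Lemma chain_cat N P L i j : L `<=` P -> P `<=` N ->
  chain (subint P L) i -> chain (subint N P) j -> chain (subint N L) (i + j).
Proof.
move=> LP PN [C [PC CC]] [D [PD DD]].
exists (fun k => if (k <= i)%N then C k else D (k - i)%N); split=> k hk.
  case: leqP => hki.
    by have [? ? ?] := PC _ hki; split=> //; apply: subset_trans PN.
  have [|? ? ?] := PD (k - i)%N; first by lia.
  by split=> //; apply: subset_trans LP _.
case: (ltnP k i) => hki; first by rewrite (ltnW hki); apply: CC.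
(* At the seam [D 0] is skipped: [C i] lies in P, hence in [D 0], hence strictly in [D 1]. *)
case: (leqP k i) => hki'.
  have -> : k = i by lia.
  rewrite subSn // subnn.
  have /DD[h1 h2] : (0 < j)%N by lia.
  have [_ _ CP] := PC i (leqnn i); have [_ PD0 _] := PD 0%N (leq0n _).
  split; first by apply: subset_trans CP _; apply: subset_trans PD0 _.
  by move=> h; apply: h2; apply: subset_trans h _; apply: subset_trans CP _.
by rewrite subSn; [apply: DD; lia|lia].
Qed.

(** Intersecting a chain with P and adding P to it gives two weak chains; no strict step can become
    an equality in both. *)
Lemma chain_cut N P L k : submodule P -> submodule N -> L `<=` P -> P `<=` N ->
  chain (subint N L) k -> exists i j,
  [/\ chain (subint P L) i, chain (subint N P) j & (k <= i + j)%N].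
Proof.
move=> hP hN LP PN [C [PC CC]].
exists (\sum_(i < k) `[< ~ C i.+1 `&` P `<=` C i `&` P >])%N,
  (\sum_(i < k) `[< ~ sadd (C i.+1) P `<=` sadd (C i) P >])%N; split.
- apply: (chain_weak (D := fun i => C i `&` P)) => i ik.
    have [? LC ?] := PC _ ik; split; [exact: submodI|by move=> v Lv; split; auto|].
    by move=> v [].
  by apply: setSI; apply: properW; apply: CC.
- apply: (chain_weak (D := fun i => sadd (C i) P)) => i ik.
    have [? ? ?] := PC _ ik.
    by split; [exact: submod_sadd|exact: sadd_subr|exact: sadd_sub].
  by apply: sadd_mono => //; apply: properW; apply: CC.
(* Modular law: if two nested submodules have the same intersection with P and the same sum with P,
   they are equal. *)
- rewrite -big_split /= -[X in (X <= _)%N](card_ord k) -sum1_card.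
  apply: leq_sum => i _.
  case: asboolP => [_|/contrapT hI]; first by lia.
  case: asboolP => [_|/contrapT hD]; first by lia.
  have [sub nsub] := CC _ (ltn_ord i); case: nsub => v Cv.
  have [hCi _ _] : subint N L (C i) by apply: PC; apply: ltnW.
  have [hCi' _ _] : subint N L (C i.+1) by apply: PC.
  have /hD[u Cu [w Pw uwv]] : sadd (C i.+1) P v by apply: sadd_subl.
  rewrite -uwv; apply: submodD => //.
  have /hI[] // : (C i.+1 `&` P) w.
  split=> //; have -> : w = v - u by rewrite -uwv addrC addKr.
  by apply: submodB => //; apply: sub.
Qed.

Lemma finlen_add N P L : submodule N -> submodule P -> submodule L ->
  L `<=` P -> P `<=` N -> finlen N P -> finlen P L ->
  max_chain (subint N L) (quot_length N P + quot_length P L)%N.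
Proof.
move=> hN hP hL LP PN /finlenP[c1 m1] /finlenP[c2 m2]; split.
  by rewrite addnC; apply: chain_cat c2 c1.
move=> k /(chain_cut hP hN LP PN)[i [j [/m2 h2 /m1 h1 kij]]].
by apply: leq_trans kij _; rewrite addnC leq_add.
Qed.

Lemma finlen_sub N P L : submodule N -> submodule P -> submodule L ->
  L `<=` P -> P `<=` N -> finlen N L -> finlen N P /\ finlen P L.
Proof.
move=> hN hP hL LP PN [k [_ mk]]; split; apply: (@max_chain_ex _ _ k).
- exact: subint_chain0.
- move=> j cj; apply: mk.
  exact: (@chain_cat _ _ _ 0 j LP PN (subint_chain0 hL LP) cj).
- exact: subint_chain0.
- move=> j cj; apply: mk; rewrite -[j]addn0.
  exact: chain_cat LP PN cj (subint_chain0 hP PN).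
Qed.

Lemma quot_length_add N P L : submodule N -> submodule P -> submodule L ->
  L `<=` P -> P `<=` N -> finlen N L ->
  quot_length N L = (quot_length N P + quot_length P L)%N.
Proof.
move=> hN hP hL LP PN fNL; have [f1 f2] := finlen_sub hN hP hL LP PN fNL.
by apply: quot_lengthE; apply: finlen_add.
Qed.

Lemma quot_length0 N : submodule N ->
  max_chain (subint N N) 0.
Proof.
move=> hN; split; first exact: subint_chain0.
case=> // j [C [PC CC]]; have [_ []] := CC 0%N (ltn0Sn _).
have [_ h _] := PC 0%N (leq0n _); have [_ _ h'] := PC 1%N (ltn0Sn _).
exact: subset_trans h' h.
Qed.

Lemma quot_length_eq0 N L : submodule N -> submodule L -> L `<=` N ->
  finlen N L -> quot_length N L = 0%N -> N = L.
Proof.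
move=> hN hL LN /finlenP[_ mx] q0; rewrite eqEsubset; split=> //.
apply: contrapT => NL.
suff /mx : chain (subint N L) 1 by rewrite q0.
exists (fun i => if i is 0 then L else N).
by split=> [[|[|i]]|[|i]] // _; split=> //; apply: subset_refl.
Qed.

End Length.

(** The second isomorphism theorem, A / (A cap B) = (A + B) / B, on the level of intermediate
    submodules. *)
Lemma quot_length_modular (S : comNzRingType) (V : lmodType S) (A B : set V) k :
  submodule A -> submodule B ->
  max_chain (subint A (A `&` B)) k <-> max_chain (subint (sadd A B) B) k.
Proof.
move=> hA hB.
apply: (@quot_length_iso _ _ _ _ A (A `&` B) (sadd A B) B
          (fun C => sadd C B) (fun D => A `&` D)).
- move=> C hC ABC CA; split; [exact: submod_sadd|exact: sadd_subr|].
  exact: sadd_mono.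
- by move=> C hC BC CAB; split; [exact: submodI|exact: setIS|move=> v []].
- by move=> C D CD; apply: sadd_mono.
- by move=> C D CD; apply: setIS.
- move=> C hC ABC CA; rewrite eqEsubset; split=> [v [Av [u Cu [w Bw uwv]]]|v Cv].
    rewrite -uwv; apply: submodD => //; apply: ABC; split=> //.
    by rewrite -(addKr u w) uwv addrC; apply: submodB => //; apply: CA.
  by split; [exact: CA|exact: sadd_subl].
- move=> D hD BD DAB; rewrite eqEsubset; split.
    by apply: sadd_sub => // v [].
  move=> v Dv; have [u Au [w Bw uwv]] := DAB _ Dv; exists u; last by exists w.
  split=> //; rewrite -(addrK w u) uwv; apply: submodB => //; exact: BD.
Qed.

(** * Ideals, and the operations A x + I and I : x *)

Section Ideals.
Variable R : comNzRingType.
Implicit Types (I J K A B : set R) (a b r x : R) (s : seq R).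

Lemma ideal_intro I : I 0 -> (forall u v, I u -> I v -> I (u + v)) ->
  (forall a u, I u -> I (a * u)) -> ideal I.
Proof. exact: (@submodP _ R^o). Qed.

Lemma ideal0 I : ideal I -> I 0.
Proof. exact: (@submod0 _ R^o). Qed.

Lemma idealD I a b : ideal I -> I a -> I b -> I (a + b).
Proof. exact: (@submodD _ R^o). Qed.

Lemma idealB I a b : ideal I -> I a -> I b -> I (a - b).
Proof. exact: (@submodB _ R^o). Qed.

Lemma idealN I a : ideal I -> I a -> I (- a).
Proof. exact: (@submodN _ R^o). Qed.

Lemma idealMl I a b : ideal I -> I b -> I (a * b).
Proof. exact: (@submodZ _ R^o). Qed.

Lemma idealMr I a b : ideal I -> I a -> I (a * b).
Proof. by move=> hI Ia; rewrite mulrC; apply: idealMl. Qed.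

Lemma idealT : ideal (setT : set R).
Proof. exact: (@submodT _ R^o). Qed.

Lemma ideal_set0 : ideal ([set 0] : set R).
Proof. exact: (@submod_set0 _ R^o). Qed.

Lemma idealI I J : ideal I -> ideal J -> ideal (I `&` J).
Proof. exact: (@submodI _ R^o). Qed.

Lemma ideal_eqT I : ideal I -> I 1 -> I = setT.
Proof.
move=> hI I1; rewrite eqEsubset; split=> // a _.
by rewrite -[a]mulr1; apply: idealMl.
Qed.

Lemma ideal_ideal_of (X : set R) : ideal (ideal_of X).
Proof. exact: (@submod_span _ R^o). Qed.

Lemma sub_ideal_of (X : set R) : X `<=` ideal_of X.
Proof. exact: (@generators_span _ R^o). Qed.

Lemma ideal_of_sub (X : set R) I : ideal I -> X `<=` I -> ideal_of X `<=` I.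
Proof. exact: (@span_min _ R^o). Qed.

Lemma ideal_of_mono (X Y : set R) : X `<=` Y -> ideal_of X `<=` ideal_of Y.
Proof.
move=> XY; apply: ideal_of_sub; first exact: ideal_ideal_of.
by apply: subset_trans XY _; apply: sub_ideal_of.
Qed.

Lemma ideal_idadd I J : ideal I -> ideal J -> ideal (idadd I J).
Proof. exact: (@submod_sadd _ R^o). Qed.

Lemma idadd_subl I J : ideal J -> I `<=` idadd I J.
Proof. exact: (@sadd_subl _ R^o). Qed.

Lemma idadd_subr I J : ideal I -> J `<=` idadd I J.
Proof. exact: (@sadd_subr _ R^o). Qed.

Lemma idadd_sub I J K : ideal K -> I `<=` K -> J `<=` K -> idadd I J `<=` K.
Proof. exact: (@sadd_sub _ R^o). Qed.

Lemma idadd_mono I I' J J' : I `<=` I' -> J `<=` J' -> idadd I J `<=` idadd I' J'.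
Proof. exact: (@sadd_mono _ R^o). Qed.

Lemma ideal_idmul I J : ideal (idmul I J).
Proof. exact: (@submod_smul _ R^o). Qed.

Lemma mem_idmul I J a b : I a -> J b -> idmul I J (a * b).
Proof. exact: (@mem_smul _ R^o). Qed.

Lemma idmul_sub I J K : ideal K -> (forall a b, I a -> J b -> K (a * b)) ->
  idmul I J `<=` K.
Proof. exact: (@smul_sub _ R^o). Qed.

Lemma idmul_mono I I' J J' :
  I `<=` I' -> J `<=` J' -> idmul I J `<=` idmul I' J'.
Proof.
move=> h h'; apply: idmul_sub; first exact: ideal_idmul.
by move=> a b /h Ia /h' Jb; apply: mem_idmul.
Qed.

Lemma idmulCA I J K : idmul I (idmul J K) = idmul J (idmul I K).
Proof.
suff h I' J' K' : idmul I' (idmul J' K') `<=` idmul J' (idmul I' K').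
  by rewrite eqEsubset; split.
apply: idmul_sub; first exact: ideal_idmul.
move=> a w Ia Jw.
have : [set w | idmul J' (idmul I' K') (a * w)] w; last by [].
move: w Jw; apply: idmul_sub => [|b c Jb Kc /=].
  apply: ideal_intro => [|u v /= hu hv|r u /= hu].
  - by rewrite /= mulr0; exact: ideal0 (ideal_idmul _ _).
  - by rewrite mulrDr; exact: idealD (ideal_idmul _ _) hu hv.
  - by rewrite mulrCA; exact: idealMl _ (ideal_idmul _ _) hu.
by rewrite mulrCA; apply: mem_idmul => //; apply: mem_idmul.
Qed.

Lemma idmulT I : ideal I -> idmul I setT = I.
Proof.
move=> hI; rewrite eqEsubset; split.
  by apply: idmul_sub => // a b Ia _; apply: idealMr.
by move=> a Ia; rewrite -[a]mulr1; apply: mem_idmul.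
Qed.

Lemma idmul_subl I J : ideal I -> idmul I J `<=` I.
Proof. by move=> hI; apply: idmul_sub => // a b Ia _; apply: idealMr. Qed.

Lemma idmul_subr I J : ideal J -> idmul I J `<=` J.
Proof. by move=> hI; apply: idmul_sub => // a b _ Jb; apply: idealMl. Qed.

(** The ideal A x + I, in a form that hands over the coefficient of x. *)
Definition scal_add A x I : set R := [set a | exists2 r, A r & I (a - r * x)].

Definition colon I x : set R := [set r | I (r * x)].

Lemma ideal_scal_add A x I : ideal A -> ideal I -> ideal (scal_add A x I).
Proof.
move=> hA hI; apply: ideal_intro.
- by exists 0; [exact: ideal0|rewrite mul0r subr0; exact: ideal0].
- move=> u v [r Ar hr] [t At ht]; exists (r + t); first exact: idealD.
  by rewrite mulrDl opprD addrACA; apply: idealD.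
- move=> a u [r Ar hr]; exists (a * r); first exact: idealMl.
  by rewrite -mulrA -mulrBr; apply: idealMl.
Qed.

Lemma ideal_colon I x : ideal I -> ideal (colon I x).
Proof.
move=> hI; apply: ideal_intro; rewrite /colon /=.
- by rewrite mul0r; apply: ideal0.
- by move=> u v hu hv; rewrite mulrDl; apply: idealD.
- by move=> a u hu; rewrite -mulrA; apply: idealMl.
Qed.

Lemma scal_add_subr A x I : ideal A -> I `<=` scal_add A x I.
Proof. by move=> hA a Ia; exists 0; [exact: ideal0|rewrite mul0r subr0]. Qed.

Lemma mem_scal_add A x I r : ideal I -> A r -> scal_add A x I (r * x).
Proof. by move=> hI Ar; exists r => //; rewrite subrr; apply: ideal0. Qed.

Lemma scal_add_sub A x I K : ideal K -> (forall r, A r -> K (r * x)) ->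
  I `<=` K -> scal_add A x I `<=` K.
Proof.
move=> hK AK IK a [r Ar Iar]; rewrite -(subrK (r * x) a).
by apply: idealD; [|apply: IK|apply: AK].
Qed.

Lemma colon_sub I x : ideal I -> I `<=` colon I x.
Proof. by move=> hI a Ia; apply: idealMr. Qed.

Lemma ideal_of_rcons s x :
  ideal_of [set` rcons s x] = scal_add setT x (ideal_of [set` s]).
Proof.
rewrite eqEsubset; split.
  apply: ideal_of_sub.
    exact: ideal_scal_add idealT (ideal_ideal_of _).
  move=> a /=; rewrite mem_rcons inE => /predU1P[->|sa].
    by exists 1 => //; rewrite mul1r subrr; exact: ideal0 (ideal_ideal_of _).
  by apply: scal_add_subr; [exact: idealT|exact: sub_ideal_of].
apply: scal_add_sub; first exact: ideal_ideal_of.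
  move=> r _; apply: (idealMl _ (ideal_ideal_of _)).
  by apply: sub_ideal_of; rewrite /= mem_rcons mem_head.
by apply: ideal_of_mono => a /= sa; rewrite mem_rcons inE sa orbT.
Qed.

Lemma ideal_of_nil : ideal_of [set` [::]] = [set 0 : R].
Proof.
rewrite eqEsubset; split.
  by apply: ideal_of_sub => //; exact: ideal_set0.
by move=> a ->; exact: ideal0 (ideal_ideal_of _).
Qed.

Lemma ideal_of_set1 x a : ideal_of [set x] a <-> exists r, a = r * x.
Proof.
split=> [|[r ->]]; last first.
  by apply: (idealMl _ (ideal_ideal_of _)); exact: sub_ideal_of.
move: a; apply: (@ideal_of_sub [set x] [set a | exists r, a = r * x]).
  apply: ideal_intro.
  - by exists 0; rewrite mul0r.
  - by move=> _ _ [r ->] [t ->]; exists (r + t); rewrite mulrDl.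
  - by move=> a _ [r ->]; exists (a * r); rewrite mulrA.
by move=> _ ->; exists 1; rewrite mul1r.
Qed.

Definition finlength I := finlen (setT : set R^o) I.

(** Multiplication by x identifies R / (I : x) with (R x + I) / I. *)
Lemma quot_length_colon I x k : ideal I ->
  max_chain (subint (setT : set R^o) (colon I x)) k <->
  max_chain (subint (scal_add setT x I : set R^o) I) k.
Proof.
move=> hI.
apply: (@quot_length_iso _ _ R^o R^o setT (colon I x) (scal_add setT x I) I
          (fun C => scal_add C x I) (fun D => colon D x)).
- move=> C hC IC _; split; [exact: ideal_scal_add|exact: scal_add_subr|].
  by move=> a [r _ h]; exists r.
- move=> C hC IC _; split=> //; first exact: ideal_colon.
  by move=> a; apply: IC.
- by move=> C D CD a [r Cr h]; exists r => //; apply: CD.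
- by move=> C D CD a; apply: CD.
- move=> C hC IC _; rewrite eqEsubset; split=> a.
    move=> [r Cr]; rewrite -mulrBl => /IC h.
    by rewrite -(subrK r a); apply: idealD.
  by move=> Ca; apply: mem_scal_add.
- move=> D hD ID DI; rewrite eqEsubset; split.
    by apply: scal_add_sub.
  move=> a Da; have [r _ h] := DI _ Da; exists r => //=.
  rewrite /colon /=; have -> : r * x = a - (a - r * x) by ring.
  by apply: idealB => //; apply: ID.
Qed.

(** Filter R / I by the ideals R g^k + I, which reach I at k = e. Each factor is cyclic and killed
    by g and I, hence a quotient of R / (R g + I). *)
Lemma finlength_step I g e :
  ideal I -> I (g ^+ e) -> finlength (scal_add setT g I) -> finlength I.
Proof.
move=> hI Ie fg; have hs k := ideal_scal_add (g ^+ k) idealT hI.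
have -> : I = scal_add setT (g ^+ e) I.
  rewrite eqEsubset; split; first exact: scal_add_subr idealT.
  by apply: scal_add_sub => // r _; apply: idealMl.
have sT : scal_add setT (g ^+ 0) I = setT.
  apply: ideal_eqT; first exact: hs.
  by exists 1 => //; rewrite expr0 mulr1 subrr; apply: ideal0.
elim: e {Ie} => [|e IH].
  by rewrite sT; exists 0%N; apply: quot_length0; apply: idealT.
set L := scal_add setT (g ^+ e.+1) I; set P := scal_add setT (g ^+ e) I in IH.
have LP : L `<=` P.
  apply: scal_add_sub; [exact: hs|move=> r _|exact: scal_add_subr idealT].
  by rewrite exprS mulrA; apply: mem_scal_add.
exists (quot_length (setT : set R^o) P + quot_length (P : set R^o) L)%N.
apply: finlen_add => //; [exact: idealT|exact: hs|exact: hs|].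
have PE : P = scal_add setT (g ^+ e) L.
  rewrite eqEsubset; split.
    by apply: scal_add_sub; [exact: ideal_scal_add idealT (hs _)
      |move=> r _; apply: mem_scal_add => //; exact: hs
      |move=> a Ia; do 2 (apply: scal_add_subr; first exact: idealT)].
  by apply: scal_add_sub; [exact: hs|move=> r _; apply: mem_scal_add|].
rewrite PE; suff [k hk] : finlength (colon L (g ^+ e)).
  by exists k; apply/quot_length_colon => //; exact: hs.
have [||||||fc _] := @finlen_sub _ R^o setT (colon L (g ^+ e)) (scal_add setT g I).
- exact: idealT.
- by apply: ideal_colon; apply: hs.
- by apply: ideal_scal_add => //; exact: idealT.
- apply: scal_add_sub; first by apply: ideal_colon; apply: hs.
    by move=> r _; rewrite /colon /= -mulrA -exprS; exact: mem_scal_add.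
  by move=> a Ia; apply: (colon_sub _ (hs _)); apply: (scal_add_subr _ idealT).
- by [].
- by [].
- exact: fc.
Qed.

End Ideals.

Arguments idealT {R}.
Arguments ideal_set0 {R}.

(** * Colength of m-primary ideals *)

Section FiniteColength.
Variables (R : comNzRingType) (m : set R).
Hypotheses (noeth : noetherian R) (mmax : maximal_ideal m).
Implicit Types (I J K A B N L : set R) (a b r x : R) (s : seq R).

Definition mprimary I := ideal I /\ m `<=` radical I.

Lemma finlength_sup_max I : ideal I -> m `<=` I -> finlength I.
Proof.
move=> hI mI; apply: (@max_chain_ex _ _ 1%N).
  exact: (@subint_chain0 _ R^o).
case=> [|[|j]] // [C [PC CC]]; exfalso.
have [_ _ mx] := mmax.
have /CC[_ n01] : (0 < j.+2)%N by [].
have /CC[_ n12] : (1 < j.+2)%N by [].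
have [i0 I0 _] := PC 0%N (leq0n _); have [i1 I1 _] := PC 1%N (ltn0Sn _).
case: (mx _ i1 (subset_trans mI I1)) => e1; last by apply: n12; rewrite e1.
by apply: n01; rewrite e1; apply: subset_trans mI I0.
Qed.

(** Adding all generators of m to I gives an ideal containing m. The generators are then removed one
    by one with [finlength_step], since each has a power in I. *)
Lemma finlength_mprimary I : mprimary I -> finlength I.
Proof.
move=> [hI mI]; have [hm _ _] := mmax; have [s ms] := noeth hm.
have sI g : g \in s -> radical I g.
  by move=> sg; apply: mI; rewrite ms; apply: sub_ideal_of.
have [hF IF sF] : [/\ ideal (foldr (scal_add setT) I s),
    I `<=` foldr (scal_add setT) I s &
    [set` s] `<=` foldr (scal_add setT) I s].
  elim: s {ms sI} => [|g s [hF IF sF]] /=; first by split=> //; apply: subset_refl.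
  have h := ideal_scal_add g idealT hF.
  split=> //; first exact: subset_trans IF (scal_add_subr _ idealT).
  move=> a /=; rewrite inE => /predU1P[->|sa].
    by have := @mem_scal_add _ setT g _ 1 hF; rewrite mul1r; apply.
  by apply: (scal_add_subr _ idealT); apply: sF.
have : finlength (foldr (scal_add setT) I s).
  by apply: finlength_sup_max => //; rewrite ms; apply: ideal_of_sub.
elim: s sI {ms hF IF sF} => [|g s IH] //= sI.
have hF : ideal (foldr (scal_add setT) I s).
  by elim: s {IH sI} => [|h s IH] //=; apply: ideal_scal_add => //; exact: idealT.
have IF : I `<=` foldr (scal_add setT) I s.
  elim: s {IH sI hF} => [|h s IH] //=.
  exact: subset_trans IH (scal_add_subr _ idealT).
have [e Ige] := sI _ (mem_head _ _).
move=> /(finlength_step hF (IF _ Ige)); apply: IH => h sh.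
by apply: sI; rewrite inE sh orbT.
Qed.

Lemma mprimary_sup I J : ideal J -> I `<=` J -> mprimary I -> mprimary J.
Proof.
by move=> hJ IJ [hI mI]; split=> // a /mI[n Ian]; exists n; apply: IJ.
Qed.

Lemma mprimaryT : mprimary setT.
Proof. by split; [exact: idealT|move=> a _; exists 0%N]. Qed.

Lemma mprimary_idmul I J : mprimary I -> mprimary J -> mprimary (idmul I J).
Proof.
move=> [hI mI] [hJ mJ]; split; first exact: ideal_idmul.
move=> a ma; have [n In] := mI _ ma; have [k Jk] := mJ _ ma.
by exists (n + k)%N; rewrite exprD; apply: mem_idmul.
Qed.

Lemma mprimary_idexp I n : mprimary I -> mprimary (idexp I n).
Proof.
by move=> hI; elim: n => [|n IH]; [exact: mprimaryT|apply: mprimary_idmul].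
Qed.

Lemma mprimaryI I J : mprimary I -> mprimary J -> mprimary (I `&` J).
Proof.
move=> hI hJ; have [iI _] := hI; have [iJ _] := hJ.
apply: mprimary_sup (mprimary_idmul hI hJ); first exact: idealI.
by move=> a h; split; [exact: idmul_subl h|exact: idmul_subr h].
Qed.

Lemma mprimary_idadd I J : mprimary I -> ideal J -> mprimary (idadd I J).
Proof.
move=> hI hJ; have [iI _] := hI.
by apply: mprimary_sup hI; [exact: ideal_idadd|exact: idadd_subl].
Qed.

Definition colength I : int := (idlength setT I)%:Z.

Lemma idlengthE N L : ideal N -> mprimary L -> L `<=` N ->
  (idlength N L)%:Z = colength L - colength N.
Proof.
move=> hN hL LN; have [iL _] := hL.
have e : idlength setT L = (idlength setT N + idlength N L)%N.
  apply: (@quot_length_add _ R^o setT N L) => //; first exact: idealT.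
  exact: finlength_mprimary.
by rewrite /colength e PoszD addrAC subrr add0r.
Qed.

Lemma colength_mono N L : ideal N -> mprimary L -> L `<=` N ->
  colength N <= colength L.
Proof. by move=> hN hL LN; rewrite -subr_ge0 -idlengthE. Qed.

Lemma colength_inj N L : ideal N -> mprimary L -> L `<=` N ->
  colength L = colength N -> L = N.
Proof.
move=> hN hL LN e; have [iL _] := hL; apply/esym.
apply: (@quot_length_eq0 _ R^o) => //.
  have [||||||_ //] := @finlen_sub _ R^o setT N L; try by [].
    exact: idealT.
  exact: finlength_mprimary.
by have := idlengthE hN hL LN; rewrite e subrr /idlength => -[].
Qed.

Lemma colengthT : colength setT = 0.
Proof.
rewrite /colength /idlength (@quot_lengthE _ R^o _ _ 0) //.
exact: (@quot_length0 _ R^o _ idealT).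
Qed.

Lemma colength_modular A B : mprimary A -> mprimary B ->
  colength A + colength B = colength (idadd A B) + colength (A `&` B).
Proof.
move=> hA hB; have [iA _] := hA; have [iB _] := hB.
have hAB := mprimaryI hA hB.
have AB : A `&` B `<=` A by move=> a [].
have iS : ideal (idadd A B) by apply: ideal_idadd.
have e1 := idlengthE iA hAB AB.
have e2 := idlengthE iS hB (@idadd_subr _ _ _ iA).
suff e : idlength A (A `&` B) = idlength (idadd A B) B.
  rewrite e e2 in e1.
  have {e1} : colength B - colength (idadd A B) + (colength A + colength (idadd A B)) =
    colength (A `&` B) - colength A + (colength A + colength (idadd A B)) by rewrite e1.
  rewrite [LHS](_ : _ = colength A + colength B); last by ring.
  by move=> ->; ring.
apply: esym; apply: (@quot_lengthE _ R^o).
apply/(@quot_length_modular _ R^o A B) => //.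
apply: (@finlenP _ R^o).
have [||||||//] := @finlen_sub _ R^o setT A (A `&` B); try by [].
- exact: idealT.
- by have [] := hAB.
- exact: finlength_mprimary.
Qed.

(** Additivity on 0 -> R / (I : x) -> R / I -> R / (R x + I) -> 0. *)
Lemma colength_colon I x : mprimary I ->
  colength I = colength (scal_add setT x I) + colength (colon I x).
Proof.
move=> hI; have [iI _] := hI.
have hc : mprimary (colon I x).
  by apply: mprimary_sup hI; [exact: ideal_colon|exact: colon_sub].
have iS := ideal_scal_add x idealT iI.
have e1 := idlengthE iS hI (@scal_add_subr _ _ x I idealT).
suff e : idlength (scal_add setT x I) I = idlength setT (colon I x).
  rewrite e in e1; rewrite /colength in e1 *; rewrite e1; ring.
apply: (@quot_lengthE _ R^o); apply/quot_length_colon => //.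
exact: (@finlenP _ R^o _ _ (finlength_mprimary hc)).
Qed.

(** As x is a nonzerodivisor modulo I and I lies in A, the colon ideal (A x + I) : x is A. *)
Lemma colength_scal_add A x I : mprimary A -> I `<=` A -> ideal I ->
  mprimary (scal_add A x I) -> (forall a, I (a * x) -> I a) ->
  colength (scal_add A x I) = colength (scal_add setT x I) + colength A.
Proof.
move=> hA IA hI hS reg; have [iA _] := hA.
rewrite (colength_colon x hS); congr (colength _ + colength _).
  rewrite eqEsubset; split.
    apply: scal_add_sub; first exact: ideal_scal_add idealT hI.
      by move=> r _; apply: mem_scal_add.
    by move=> a [r _ h]; exists r.
  apply: scal_add_sub; first by apply: ideal_scal_add; [exact: idealT|case: hS].
    by move=> r _; apply: mem_scal_add => //; case: hS.
  move=> a Ia; apply: (scal_add_subr _ idealT).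
  exact: (scal_add_subr _ iA).
rewrite eqEsubset; split=> a; last by move=> Aa; apply: mem_scal_add.
move=> [r Ar]; rewrite -mulrBl => /reg /IA h.
by rewrite -(subrK r a); apply: idealD.
Qed.

(** By Zorn, a non-unit lies in a maximal ideal, and m is the only one. *)
Lemma local_inv u : local_ring m -> ~ m u -> exists v, v * u = 1.
Proof.
move=> loc mu; apply: contrapT => nu; apply: mu.
(* Zorn_bigcup also asks for the union of the empty chain. *)
pose P : set (set R) := [set I | forall a, I a -> [/\ ideal I, I u & ~ I 1]].
have [|M [PM Mmax]] := @Zorn_bigcup _ P.
  move=> F FP tot a0 [I0 FI0 I0a].
  have FD I J a b : F I -> F J -> I a -> J b -> exists2 K, F K & K a /\ K b.
    move=> FI FJ Ia Jb; case: (tot _ _ FI FJ) => h.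
      by exists J => //; split=> //; apply: h.
    by exists I => //; split=> //; apply: h.
  have [i0 I0u _] := FP _ FI0 _ I0a; split.
  - apply: ideal_intro.
    + by exists I0 => //; apply: ideal0.
    + move=> a b [I FI Ia] [J FJ Jb]; have [K FK [Ka Kb]] := FD _ _ _ _ FI FJ Ia Jb.
      by exists K => //; have [iK _ _] := FP _ FK _ Ka; apply: idealD.
    + move=> a b [I FI Ib]; have [iI _ _] := FP _ FI _ Ib.
      by exists I => //; apply: idealMl.
  - by exists I0.
  - by move=> [I FI I1]; have [_ _] := FP _ FI _ I1.
have Pu : P (ideal_of [set u]).
  move=> _ _; split; [exact: ideal_ideal_of|exact: sub_ideal_of|].
  by move=> /ideal_of_set1[v v1]; apply: nu; exists v.
have [M0|/set0P[a Ma]] := eqVneq M set0.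
  exfalso; apply: (Mmax _ _ Pu); rewrite M0; split=> //.
  by move=> /(_ u); apply; apply: sub_ideal_of.
have [iM Mu M1] := PM _ Ma.
suff /loc <- : maximal_ideal M by [].
split=> //; first by move=> MT; apply: M1; rewrite MT.
move=> I iI MI; have [I1|I1] := pselect (I 1); first by right; apply: ideal_eqT.
left; rewrite eqEsubset; split=> //; apply: contrapT => nIM.
apply: (Mmax I); first by split.
by move=> b Ib; split=> //; apply: MI.
Qed.

End FiniteColength.

(** * The Koszul complex on N / L *)

Section Koszul.
Variables (S : comNzRingType) (V : lmodType S).
Implicit Types (c b : seq bool -> V) (xs fs : seq S) (s t : seq bool).
Implicit Types (N L : set V).

(* The cochains of degree i of the Koszul complex of xs are the functions on
   the boolean words of length size xs with i letters true, that is, on the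
   i-subsets of the generators; values elsewhere are irrelevant. *)
Fixpoint koszul_d xs c s : V :=
  match xs, s with
  | x :: xs', true :: s' =>
      x *: c (false :: s') - koszul_d xs' (fun t => c (true :: t)) s'
  | _ :: xs', false :: s' => koszul_d xs' (fun t => c (false :: t)) s'
  | _, _ => 0
  end.

(** Contraction with the j-th generator, signed by the true letters before position j. It is the
    homotopy showing that x_j acts as zero on Koszul cohomology. *)
Fixpoint koszul_h xs j c s : V :=
  match xs, j, s with
  | _ :: xs', 0, false :: s' => c (true :: s')
  | _ :: xs', j'.+1, false :: s' => koszul_h xs' j' (fun t => c (false :: t)) s'
  | _ :: xs', j'.+1, true :: s' => - koszul_h xs' j' (fun t => c (true :: t)) s'
  | _, _, _ => 0
  end.

Lemma koszul_d_lin xs a c b s :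
  koszul_d xs (fun t => a *: c t + b t) s = a *: koszul_d xs c s + koszul_d xs b s.
Proof.
elim: xs c b s => [|x xs IH] c b [|[] s] /=; rewrite ?scaler0 ?addr0 //.
by rewrite (IH (fun t => c (true :: t)) (fun t => b (true :: t))) !scalerDr
  scalerN !scalerA (mulrC x) opprD addrACA.
Qed.

Lemma koszul_h_lin xs j a c b s :
  koszul_h xs j (fun t => a *: c t + b t) s = a *: koszul_h xs j c s + koszul_h xs j b s.
Proof.
elim: xs j c b s => [|x xs IH] [|j] c b [|[] s] /=; rewrite ?scaler0 ?addr0 //.
by rewrite (IH j (fun t => c (true :: t)) (fun t => b (true :: t))) opprD scalerN.
Qed.

Lemma koszul_d0 xs s : koszul_d xs (fun=> 0) s = 0.
Proof.
by elim: xs s => [|x xs IH] [|[] s] //=; rewrite IH scaler0 subr0.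
Qed.

Lemma koszul_h0 xs j s : koszul_h xs j (fun=> 0) s = 0.
Proof. by elim: xs j s => [|x xs IH] [|j] [|[] s] //=; rewrite IH ?oppr0. Qed.

Lemma koszul_dD xs c b s :
  koszul_d xs (fun t => c t + b t) s = koszul_d xs c s + koszul_d xs b s.
Proof.
rewrite -[koszul_d xs c s]scale1r -koszul_d_lin; congr koszul_d.
by apply: funext => t; rewrite scale1r.
Qed.

Lemma koszul_dZ xs a c s : koszul_d xs (fun t => a *: c t) s = a *: koszul_d xs c s.
Proof.
rewrite -[RHS]addr0 -(koszul_d0 xs s) -koszul_d_lin; congr koszul_d.
by apply: funext => t; rewrite addr0.
Qed.

Lemma koszul_dN xs c s : koszul_d xs (fun t => - c t) s = - koszul_d xs c s.
Proof.
rewrite -scaleN1r -koszul_dZ; congr koszul_d.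
by apply: funext => t; rewrite scaleN1r.
Qed.

Lemma koszul_dB xs c b s :
  koszul_d xs (fun t => c t - b t) s = koszul_d xs c s - koszul_d xs b s.
Proof. by rewrite koszul_dD koszul_dN. Qed.

Lemma koszul_dd xs c s : koszul_d xs (koszul_d xs c) s = 0.
Proof.
elim: xs c s => [|x xs IH] c [|[] s] //=.
by rewrite koszul_dB koszul_dZ IH subr0 subrr.
Qed.

Lemma koszul_hN xs j c s : koszul_h xs j (fun t => - c t) s = - koszul_h xs j c s.
Proof.
rewrite -scaleN1r -[RHS]addr0 -(koszul_h0 xs j s) -koszul_h_lin.
by congr koszul_h; apply: funext => t; rewrite scaleN1r addr0.
Qed.

Lemma koszul_homotopy xs j c s : (j < size xs)%N -> size s = size xs ->
  koszul_d xs (koszul_h xs j c) s + koszul_h xs j (koszul_d xs c) s =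
  xs`_j *: c s.
Proof.
elim: xs j c s => [|x xs IH] [|j] c [|[] s] //= jk [sk].
- by rewrite koszul_d0 subr0 addr0.
- by rewrite addrC subrK.
- rewrite (koszul_dN _ (koszul_h xs j _)) opprK.
  have := koszul_h_lin xs j x (fun t => c (false :: t))
    (fun t => - koszul_d xs (fun t0 => c (true :: t0)) t) s.
  move=> /= ->; rewrite opprD addrACA subrr add0r -(IH j (fun t => c (true :: t))) //; congr (_ + _).
  by rewrite (koszul_hN _ _ (koszul_d xs _)) opprK.
- exact: IH.
Qed.

Lemma koszul_d_sub L xs c s : submodule L -> size s = size xs ->
  (forall t, size t = size xs -> (count id t).+1 = count id s -> L (c t)) ->
  L (koszul_d xs c s).
Proof.
move=> hL; elim: xs c s => [|x xs IH] c [|[] s] //=; try by move=> *; apply: submod0.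
  move=> [sk] Lc; apply: submodB => //.
    by apply: submodZ => //; apply: Lc; rewrite /= ?sk ?add0n ?add1n.
  by apply: IH => // t tk ts; apply: Lc; rewrite /= ?tk ?add1n ?ts.
move=> [sk] Lc; apply: IH => // t tk ts; apply: Lc; rewrite /= ?tk ?add0n //.
Qed.

Lemma koszul_h_sub L xs j c s : submodule L -> size s = size xs ->
  (forall t, size t = size xs -> count id t = (count id s).+1 -> L (c t)) ->
  L (koszul_h xs j c s).
Proof.
move=> hL; elim: xs j c s => [|x xs IH] [|j] c [|[] s] //=;
  try by move=> *; apply: submod0.
- by move=> [sk] Lc; apply: Lc; rewrite /= ?sk ?add0n ?add1n.
- move=> [sk] Lc; apply: submodN => //; apply: IH => // t tk ts.
  by apply: Lc; rewrite /= ?tk ?ts ?add1n.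
- move=> [sk] Lc; apply: IH => // t tk ts.
  by apply: Lc; rewrite /= ?tk ?ts ?add0n.
Qed.

Lemma koszul_h_num N xs j c s : submodule N -> (forall t, N (c t)) ->
  N (koszul_h xs j c s).
Proof.
move=> hN; elim: xs j c s => [|x xs IH] [|j] c [|[] s] Nc //=;
  try exact: submod0; try exact: IH.
by apply: submodN => //; apply: IH.
Qed.

Lemma koszul_d_num N xs c s : submodule N -> (forall t, N (c t)) ->
  N (koszul_d xs c s).
Proof.
move=> hN; elim: xs c s => [|x xs IH] c [|[] s] Nc //=;
  try exact: submod0; try exact: IH.
by apply: submodB => //; [apply: submodZ|apply: IH].
Qed.

Definition koszul_cocycle xs N L i c := (forall s, N (c s)) /\
  forall s, size s = size xs -> count id s = i.+1 -> L (koszul_d xs c s).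

(** Vanishing of the i-th cohomology of the complex on N / L. For i = 0 the differential of b is 0
    on the only relevant word, so cocycles must have their value in L there. *)
Definition koszul_exact xs N L i := forall c, koszul_cocycle xs N L i c ->
  exists2 b, forall s, N (b s) &
    forall s, size s = size xs -> count id s = i -> L (c s - koszul_d xs b s).

Definition scale_add (y : S) N L := [set v | exists2 u, N u & L (v - y *: u)].

Lemma submod_scale_add y N L : submodule N -> submodule L ->
  submodule (scale_add y N L).
Proof.
move=> hN hL; apply: submodP.
- by exists 0; [exact: submod0|rewrite scaler0 subr0; exact: submod0].
- move=> u v [r Nr hr] [t Nt ht]; exists (r + t); first exact: submodD.
  by rewrite scalerDr opprD addrACA; apply: submodD.
- move=> a u [r Nr hr]; exists (a *: r); first exact: submodZ.
  by rewrite scalerA mulrC -scalerA -scalerBr; apply: submodZ.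
Qed.

Lemma scale_add_subr y N L : submodule N -> L `<=` scale_add y N L.
Proof. by move=> hN v Lv; exists 0; [exact: submod0|rewrite scaler0 subr0]. Qed.

(** The generators kill cohomology by the homotopy, and the elements that kill the class of c form
    an ideal. *)
Lemma koszul_annihilate xs N L i c y : submodule N -> submodule L ->
  koszul_cocycle xs N L i c -> ideal_of [set` xs] y ->
  exists2 b, forall s, N (b s) & forall s, size s = size xs -> count id s = i ->
    L (y *: c s - koszul_d xs b s).
Proof.
move=> hN hL [Nc Lc].
move: y; apply: ideal_of_sub.
  apply: ideal_intro => /=.
  - exists (fun=> 0); first by move=> _; apply: submod0.
    by move=> s _ _; rewrite scale0r koszul_d0 subr0; apply: submod0.
  - move=> u v [b Nb Lb] [b' Nb' Lb'].
    exists (fun t => b t + b' t); first by move=> s; apply: submodD.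
    move=> s sk si; rewrite scalerDl koszul_dD opprD addrACA.
    by apply: submodD; [|apply: Lb|apply: Lb'].
  - move=> a u [b Nb Lb]; exists (fun t => a *: b t); first by move=> s; apply: submodZ.
    by move=> s sk si; rewrite -scalerA koszul_dZ -scalerBr; apply: submodZ => //; apply: Lb.
move=> _ /= /(nthP 0)[j jk <-].
exists (koszul_h xs j c); first by move=> s; apply: koszul_h_num.
move=> s sk si; rewrite -koszul_homotopy // addrAC subrr add0r.
by apply: koszul_h_sub => // t tk ts; apply: Lc => //; rewrite ts si.
Qed.

Lemma koszul_exact_regular0 xs N L y e : submodule N -> submodule L ->
  (forall v, N v -> L (y *: v) -> L v) -> ideal_of [set` xs] (y ^+ e) ->
  koszul_exact xs N L 0.
Proof.
move=> hN hL reg Je c zc; have [Nc _] := zc.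
have [b Nb Lb] := koszul_annihilate hN hL zc Je.
exists (fun=> 0); first by move=> _; apply: submod0.
move=> s sk s0; rewrite koszul_d0 subr0.
have {Lb} : L (y ^+ e *: c s).
  rewrite -[_ *: _](subrK (koszul_d xs b s)); apply: submodD => //; first exact: Lb.
  by apply: koszul_d_sub => // t _; rewrite s0.
elim: e {Je} => [|e IH]; first by rewrite expr0 scale1r.
by rewrite exprS -scalerA => h; apply/IH/reg => //; exact: submodZ.
Qed.

(** In the long exact sequence of multiplication by y on N / L, vanishing of H^i of the cokernel
    makes y injective on H^(i+1)(N / L). As y^e is zero there, the group vanishes; the induction on
    e divides by y once at a time. *)
Lemma koszul_exact_lift xs N L y e i : submodule N -> submodule L ->
  (forall v, N v -> L (y *: v) -> L v) -> ideal_of [set` xs] (y ^+ e) ->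
  koszul_exact xs N (scale_add y N L) i -> koszul_exact xs N L i.+1.
Proof.
move=> hN hL reg Je ex c zc; have [Nc _] := zc.
have := koszul_annihilate hN hL zc Je.
elim: e {Je} => [|e IH] [b Nb Lb].
  by exists b => // s sk si; rewrite -[c s]scale1r; apply: Lb.
have zb : koszul_cocycle xs N (scale_add y N L) i b.
  split=> // s sk si; exists (y ^+ e *: c s); first exact: submodZ.
  by rewrite scalerA -exprS -opprB; apply: submodN => //; apply: Lb.
have [a Na La] := ex _ zb.
have /choice[f hf] : forall s, exists u, N u /\
    (size s = size xs -> count id s = i -> L (b s - koszul_d xs a s - y *: u)).
  move=> s; have [[sk si]|ns] := pselect (size s = size xs /\ count id s = i).
    by have [u Nu Lu] := La _ sk si; exists u.
  by exists 0; split; [exact: submod0|move=> sk si; case: ns].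
apply: IH; exists f; first by move=> s; case: (hf s).
move=> s sk si; apply: reg.
  by apply: submodB => //; [apply: submodZ|apply: koszul_d_num => // t; case: (hf t)].
rewrite scalerBr scalerA -exprS -koszul_dZ.
have {}Lb := Lb _ sk si.
have h : L (koszul_d xs (fun t => b t - koszul_d xs a t - y *: f t) s).
  by apply: koszul_d_sub => // t tk ts; apply: (hf t).2 => //; lia.
move: h; rewrite koszul_dB koszul_dB koszul_dd subr0 => h.
by have := submodD hL Lb h; rewrite addrA subrK.
Qed.

(** The same long exact sequence read at the cokernel: f = dc / y represents the connecting map, f =
    da, and c - y a is then a cocycle on N / L. *)
Lemma koszul_exact_quot xs N L y i : submodule N -> submodule L ->
  (forall v, N v -> L (y *: v) -> L v) ->
  koszul_exact xs N L i -> koszul_exact xs N L i.+1 ->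
  koszul_exact xs N (scale_add y N L) i.
Proof.
move=> hN hL reg ex0 ex1 c [Nc Lc].
have /choice[f hf] : forall s, exists u, N u /\
    (size s = size xs -> count id s = i.+1 -> L (koszul_d xs c s - y *: u)).
  move=> s; have [[sk si]|ns] := pselect (size s = size xs /\ count id s = i.+1).
    by have [u Nu Lu] := Lc _ sk si; exists u.
  by exists 0; split; [exact: submod0|move=> sk si; case: ns].
have Nf s : N (f s) by case: (hf s).
have [|a Na La] := ex1 f.
  split=> // s sk si; apply: reg; first exact: koszul_d_num.
  have : L (koszul_d xs (fun t => koszul_d xs c t - y *: f t) s).
    by apply: koszul_d_sub => // t tk ts; apply: (hf t).2 => //; lia.
  rewrite koszul_dB koszul_dd sub0r -koszul_dZ => h.
  by rewrite -[X in L X]opprK; apply: submodN.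
have [|b Nb Lb] := ex0 (fun t => c t - y *: a t).
  split=> [s|s sk si]; first by apply: submodB => //; apply: submodZ.
  rewrite koszul_dB koszul_dZ.
  have -> : koszul_d xs c s - y *: koszul_d xs a s =
    (koszul_d xs c s - y *: f s) + y *: (f s - koszul_d xs a s).
    by rewrite scalerBr addrA subrK.
  by apply: submodD => //; [apply: (hf s).2|apply: submodZ => //; apply: La].
exists b => // s sk si; exists (a s) => //.
by rewrite addrAC; apply: Lb.
Qed.

End Koszul.

(** * Koszul exactness and regular sequences *)

Section RegularSequences.
Variables (S : comNzRingType) (V : lmodType S).
Implicit Types (xs fs : seq S) (N L : set V) (y : S).

Definition seq_sub fs N L : set V := sadd (smul [set` fs] N) L.

Lemma submod_seq_sub fs N L : submodule L -> submodule (seq_sub fs N L).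
Proof. by move=> hL; apply: submod_sadd => //; apply: submod_smul. Qed.

Lemma seq_sub_nil N L : submodule L -> seq_sub [::] N L = L.
Proof.
move=> hL; rewrite eqEsubset; split; last exact: (sadd_subr (submod_smul _ _)).
by apply: sadd_sub => //; apply: smul_sub.
Qed.

Lemma seq_sub_rcons fs y N L : submodule N -> submodule L ->
  seq_sub (rcons fs y) N L = scale_add y N (seq_sub fs N L).
Proof.
move=> hN hL; have hF := submod_seq_sub fs N hL.
have hR := submod_seq_sub (rcons fs y) N hL.
have mem g v : g \in rcons fs y -> N v -> seq_sub (rcons fs y) N L (g *: v).
  by move=> gf Nv; apply: sadd_subl => //; apply: mem_smul.
rewrite eqEsubset; split.
  apply: sadd_sub; first exact: submod_scale_add.
    apply: smul_sub; first exact: submod_scale_add.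
    move=> a v /=; rewrite mem_rcons inE => /predU1P[->|fa] Nv.
      by exists v => //; rewrite subrr; apply: submod0.
    by apply: scale_add_subr => //; apply: sadd_subl => //; apply: mem_smul.
  move=> v Lv; apply: scale_add_subr => //.
  exact: (sadd_subr (submod_smul _ _)).
move=> v [u Nu h]; rewrite -(subrK (y *: u) v); apply: submodD => //.
  move: h; apply: sadd_mono => //.
  apply: smul_sub; first exact: submod_smul.
  by move=> a w /= fa Nw; apply: mem_smul => //=; rewrite mem_rcons inE fa orbT.
by apply: mem => //; rewrite mem_rcons mem_head.
Qed.

Definition weak_regular fs N L := forall i, (i < size fs)%N ->
  forall v, N v -> seq_sub (take i fs) N L (fs`_i *: v) ->
  seq_sub (take i fs) N L v.

(** Depth sensitivity: the exact range depends on the length of a regular sequence in the radical of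
    (xs), not on how xs itself behaves. *)
Lemma koszul_exact_depth xs fs N L : submodule N -> submodule L ->
  weak_regular fs N L ->
  (forall f, f \in fs -> exists e, ideal_of [set` xs] (f ^+ e)) ->
  forall i, (i < size fs)%N -> koszul_exact xs N L i.
Proof.
move=> hN hL reg pw i ik; rewrite -(seq_sub_nil N hL) -(take0 fs).
(* Exactness in degree j modulo k terms of fs comes from degree j - 1 modulo k + 1 terms, so k has
   to vary in the induction on j. *)
suff h k j : (k + j < size fs)%N ->
    koszul_exact xs N (seq_sub (take k fs) N L) j by apply: h.
elim: j k {i ik} => [|j IH] k hk.
  have kf : (k < size fs)%N by lia.
  have [e Je] := pw _ (mem_nth 0 kf).
  by apply: koszul_exact_regular0 Je => //; [exact: submod_seq_sub|apply: reg].
have kf : (k < size fs)%N by lia.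
have [e Je] := pw _ (mem_nth 0 kf).
apply: koszul_exact_lift Je _ => //; [exact: submod_seq_sub|exact: reg|].
rewrite -seq_sub_rcons // -take_nth //; apply: IH; lia.
Qed.

(** Each regular element divided out costs one degree of exactness. *)
Lemma koszul_exact_section xs fs N L : submodule N -> submodule L ->
  weak_regular fs N L -> forall k, (forall i, (i < k)%N -> koszul_exact xs N L i) ->
  forall i, (size fs + i < k)%N -> koszul_exact xs N (seq_sub fs N L) i.
Proof.
move=> hN hL reg k ex i ik; rewrite -(take_size fs).
suff h j l : (j <= size fs)%N -> (j + l < k)%N ->
  koszul_exact xs N (seq_sub (take j fs) N L) l by apply: h.
elim: j l {i ik} => [|j IH] l jf jl; first by rewrite take0 seq_sub_nil //; apply: ex.
rewrite (take_nth 0) // seq_sub_rcons //.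
apply: koszul_exact_quot => //; [exact: submod_seq_sub|exact: reg| |]; apply: IH; lia.
Qed.

(** H^0 consists of the elements of N / L killed by xs; the constant cochain v is the cocycle to
    test. *)
Lemma koszul_exact0 xs N L v : submodule N -> submodule L -> koszul_exact xs N L 0 ->
  N v -> (forall x, x \in xs -> L (x *: v)) -> L v.
Proof.
move=> hN hL ex Nv Lv; have [|b Nb Lb] := ex (fun=> v).
  split=> // s sk _.
  elim: xs s sk Lv {ex} => [|x xs IH] [|[] s] //= => [_ _|[sk] Lv|[sk] Lv].
  - exact: submod0.
  - apply: submodB => //; first by apply: Lv; rewrite mem_head.
    by apply: IH => // y yx; apply: Lv; rewrite inE yx orbT.
  - by apply: IH => // y yx; apply: Lv; rewrite inE yx orbT.
have := Lb (nseq (size xs) false); rewrite size_nseq count_nseq mul0n => /(_ erefl erefl).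
set s := nseq _ _ => h; rewrite -(subrK (koszul_d xs b s) v); apply: submodD => //.
by apply: koszul_d_sub; rewrite ?size_nseq // => t _; rewrite count_nseq mul0n.
Qed.

(** The complex of x :: xs is the mapping cone of x on the complex of xs, so vanishing of its
    H^(i+1) makes x surjective on H^i of xs. *)
Lemma koszul_exact_tail x xs N L i c : submodule N -> submodule L ->
  koszul_exact (x :: xs) N L i.+1 -> koszul_cocycle xs N L i c ->
  exists2 c', koszul_cocycle xs N L i c' & exists2 b, forall s, N (b s) &
  forall s, size s = size xs -> count id s = i ->
    L (c s - x *: c' s + koszul_d xs b s).
Proof.
move=> hN hL ex [Nc Lc].
have [|b Nb Lb] := ex (fun s => if s is true :: t then c t else 0).
  split=> [[|[] s]|[|[] s]] //=; try exact: submod0.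
  - move=> [sk]; rewrite add1n => -[si]; rewrite scaler0 sub0r.
    by apply: submodN => //; apply: Lc.
  - by move=> _ _; rewrite koszul_d0; apply: submod0.
exists (fun t => b (false :: t)).
  split=> // s sk si; have := Lb (false :: s); rewrite /= sub0r sk si => /(_ erefl erefl) h.
  by rewrite -[koszul_d _ _ _]opprK; apply: submodN.
exists (fun t => b (true :: t)) => // s sk si.
have := Lb (true :: s); rewrite /= sk si => /(_ erefl erefl).
by rewrite opprB addrCA addrC addrAC.
Qed.

Lemma koszul_d_top xs N b s : submodule N -> (forall s, N (b s)) ->
  smul [set` xs] N (koszul_d xs b s).
Proof.
move=> hN; elim: xs b s => [|x xs IH] b [|[] s] Nb //=;
  try exact: submod0 (submod_smul _ _).
  apply: (submodB (submod_smul _ _)).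
    by apply: mem_smul => //=; rewrite mem_head.
  move: (IH (fun t => b (true :: t)) s (fun t => Nb _)).
  apply: smul_sub; first exact: submod_smul.
  by move=> a v /= ax Nv; apply: mem_smul => //=; rewrite inE ax orbT.
move: (IH (fun t => b (false :: t)) s (fun t => Nb _)).
apply: smul_sub; first exact: submod_smul.
by move=> a v /= ax Nv; apply: mem_smul => //=; rewrite inE ax orbT.
Qed.

Lemma koszul_d_top_surj xs N w : submodule N -> smul [set` xs] N w ->
  exists2 b, forall s, N (b s) & koszul_d xs b (nseq (size xs) true) = w.
Proof.
move=> hN; move: w; apply: (@smul_sub _ _ _ _ [set w | exists2 b, forall s, N (b s) &
  koszul_d xs b (nseq (size xs) true) = w]).
  apply: submodP.
  - by exists (fun=> 0); [move=> _; exact: submod0|rewrite koszul_d0].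
  - move=> _ _ [b Nb <-] [b' Nb' <-]; exists (fun t => b t + b' t).
      by move=> s; apply: submodD.
    by rewrite koszul_dD.
  - move=> a _ [b Nb <-]; exists (fun t => a *: b t); last by rewrite koszul_dZ.
    by move=> s; apply: submodZ.
elim: xs => [|x xs IH] a v //=; rewrite inE => /predU1P[->|ax] Nv.
  exists (fun s => if s is false :: _ then v else 0).
    by move=> [|[] s] //; apply: submod0.
  by rewrite koszul_d0 subr0.
have [b Nb <-] := IH a v ax Nv.
exists (fun s => if s is true :: t then - b t else 0).
  by move=> [|[] s]; [exact: submod0|apply: submodN|exact: submod0].
by rewrite scaler0 sub0r koszul_dN opprK.
Qed.

(** A relation x v = db modulo L makes (v, b) a cocycle one degree below the top; writing it as a
    coboundary puts v in (xs) N + L. *)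
Lemma koszul_exact_top x xs N L v : submodule N -> submodule L ->
  koszul_exact (x :: xs) N L (size xs) -> N v ->
  seq_sub xs N L (x *: v) -> seq_sub xs N L v.
Proof.
move=> hN hL ex Nv [w /(koszul_d_top_surj hN)[b Nb <-] [l Ll e]].
have [|b' Nb' Lb'] := ex (fun s => if s is true :: t then b t else v).
  split=> [[|[] s]|[|[] s]] //= [sk] si.
    have -> : s = nseq (size xs) true.
      have : count id s = size s by lia.
      rewrite -sk; elim: s {sk si} => [|[] s IH] //=; first by case=> /IH <-.
      by move=> h; have := count_size id s; lia.
    by rewrite -e addrC addKr.
  by have := count_size id s; lia.
have := Lb' (false :: nseq (size xs) true).
rewrite /= size_nseq count_nseq mul1n => /(_ erefl erefl) h.
rewrite -(subrK (koszul_d xs (fun t => b' (false :: t)) (nseq (size xs) true)) v).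
apply: submodD; first exact: submod_seq_sub.
  exact: (sadd_subr (submod_smul _ _)).
by apply: sadd_subl => //; apply: koszul_d_top.
Qed.

End RegularSequences.

(** * Nakayama's lemma and regularity of systems of parameters *)

Section Nakayama.
Variables (R : comNzRingType) (m : set R).

Lemma span_cons (V : lmodType R) (g u : V) (s : seq V) :
  Defs.span [set` g :: s] u -> exists r, Defs.span [set` s] (u - r *: g).
Proof.
have hs := submod_span [set` s].
move: u; apply: (@span_min _ _ _ [set u | exists r, Defs.span [set` s] (u - r *: g)]).
  apply: submodP.
  - by exists 0; rewrite scale0r subr0; exact: (submod0 hs).
  - move=> u v [r hr] [t ht]; exists (r + t).
    by rewrite scalerDl opprD addrACA; exact: submodD hs hr ht.
  - by move=> a u [r hr]; exists (a * r); rewrite -scalerA -scalerBr; exact: submodZ hs hr.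
move=> u /=; rewrite inE => /predU1P[->|us].
  by exists 1; rewrite scale1r subrr; exact: (submod0 hs).
by exists 0; rewrite scale0r subr0; apply: generators_span.
Qed.

(** Finite generation of submodules of a finite free module, needed for the module of Koszul
    cocycles. The support shrinks by one point t at a time; the values at t form an ideal, whose
    generators are lifted. *)
Lemma noetherian_ffun (T : finType) (Z : set {ffun T -> R^o}) :
  noetherian R -> submodule Z ->
  exists2 s : seq {ffun T -> R^o}, [set` s] `<=` Z & Z `<=` Defs.span [set` s].
Proof.
move=> noeth hZ.
suff h (r : seq T) (Y : set {ffun T -> R^o}) : submodule Y ->
    (forall f t, Y f -> t \notin r -> f t = 0) ->
    exists2 s : seq {ffun T -> R^o}, [set` s] `<=` Y & Y `<=` Defs.span [set` s].
  by apply: (h (enum T)) => // f t _; rewrite mem_enum.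
elim: r Y => [|t r IH] Y hY Y0.
  exists [::] => // f Yf; have -> : f = 0 by apply/ffunP => t; rewrite ffunE (Y0 f).
  exact: (submod0 (submod_span _)).
have hI : ideal [set f t | f in Y].
  apply: ideal_intro.
  - by exists 0; [exact: submod0|rewrite ffunE].
  - move=> _ _ [f Yf <-] [g Yg <-]; exists (f + g); first exact: submodD.
    by rewrite ffunE.
  - by move=> a _ [f Yf <-]; exists (a *: f); [exact: submodZ|rewrite ffunE].
have [as_ asE] := noeth _ hI.
have /choice[F hF] : forall a, exists f, [set f t | f in Y] a -> Y f /\ f t = a.
  move=> a; have [[f Yf fa]|na] := pselect ([set f t | f in Y] a); last by exists 0.
  by exists f.
have hY' : submodule (Y `&` [set f | f t = 0]).
  apply: submodI => //; apply: submodP => /=.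
  - by rewrite ffunE.
  - by move=> u v u0 v0; rewrite ffunE u0 v0 addr0.
  - by move=> a u u0; rewrite ffunE u0 scaler0.
have [|gs gsY Ygs] := IH _ hY'.
  move=> f t' [Yf ft0] t'r; have [->//|nt] := eqVneq t' t.
  by apply: Y0 => //; rewrite inE negb_or nt.
have asI a : a \in as_ -> [set f t | f in Y] a.
  by move=> ha; rewrite asE; apply: sub_ideal_of.
exists (map F as_ ++ gs).
  move=> f /=; rewrite mem_cat => /orP[/mapP[a ha ->]|/gsY[]//].
  by have [] := hF _ (asI _ ha).
set X := [set` map F as_ ++ gs]; have hX := submod_span X.
have XY : Defs.span X `<=` Y.
  apply: span_min => // f; rewrite /X /= mem_cat => /orP[/mapP[a ha ->]|/gsY[]//].
  by have [] := hF _ (asI _ ha).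
move=> f Yf.
have [h Xh ht] : [set h t | h in Defs.span X] (f t).
  have : ideal_of [set` as_] (f t) by rewrite -asE; exists f.
  apply: ideal_of_sub.
    apply: ideal_intro.
    - by exists 0; [exact: (submod0 hX)|rewrite ffunE].
    - move=> _ _ [u Yu <-] [v Yv <-]; exists (u + v); first exact: (submodD hX).
      by rewrite ffunE.
    - by move=> a _ [u Yu <-]; exists (a *: u); [exact: (submodZ _ hX)|rewrite ffunE].
  move=> a ha; exists (F a); last by have [] := hF _ (asI _ ha).
  by apply: generators_span; rewrite /X /= mem_cat map_f.
rewrite -(subrK h f); apply: (submodD hX) => //.
have : Defs.span [set` gs] (f - h).
  apply: Ygs; split; first by apply: submodB => //; apply: XY.
  by rewrite /= !ffunE ht subrr.
apply: span_min => // g hg; apply: generators_span.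
by rewrite /X /= mem_cat hg orbT.
Qed.

(** A generator g is congruent to x z', and r is the coefficient of g in z'; so (1 - x r) g lies in
    the span of the others plus B, and 1 - x r is a unit. Thus generators are discarded one by
    one. *)
Lemma nakayama (V : lmodType R) (x : R) (Z B : set V) (s : seq V) :
  local_ring m -> m x -> submodule B ->
  [set` s] `<=` Z -> Z `<=` Defs.span [set` s] ->
  (forall z, Z z -> exists2 z', Z z' & B (z - x *: z')) -> Z `<=` B.
Proof.
move=> loc mx hB sZ Zs ZB.
have [hm m1 _] : maximal_ideal m by apply/loc.
have {}Zs : Z `<=` sadd (Defs.span [set` s]) B.
  by apply: subset_trans Zs _; apply: sadd_subl.
elim: s sZ Zs => [|g s IH] sZ Zs.
  apply: subset_trans Zs _; apply: sadd_sub => //.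
  by apply: span_min.
have sZ' : [set` s] `<=` Z by move=> f fs; apply: sZ; rewrite /= inE fs orbT.
apply: IH => //; apply: (subset_trans Zs).
have hsB := submod_sadd (submod_span [set` s]) hB.
apply: sadd_sub => //; last exact: (sadd_subr (submod_span _)).
apply: span_min => // f /=; rewrite inE => /predU1P[->|fs]; last first.
  by apply: sadd_subl => //; apply: generators_span.
have Zg : Z g by apply: sZ; rewrite /= inE eqxx.
have [z' Zz' Bz'] := ZB _ Zg.
have [u us [b Bb z'E]] : sadd (Defs.span [set` g :: s]) B z'.
  exact: Zs.
have [r hr] := span_cons us.
have [v v1] : exists v, v * (1 - x * r) = 1.
  apply: (local_inv loc) => h; apply: m1; apply: ideal_eqT => //.
  rewrite -(subrK (x * r) 1); exact: idealD hm h (idealMr _ hm mx).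
rewrite -[g]scale1r -v1 -scalerA; apply: submodZ => //.
rewrite scalerBl scale1r.
have -> : g - (x * r) *: g = (g - x *: z') + x *: (u - r *: g) + x *: b.
  rewrite -z'E scalerDr scalerBr scalerA opprD (addrA g) addrACA subrK.
  by rewrite -addrA (addrAC (- (x *: b))) addNr add0r.
apply: submodD => //; last by apply: submodZ => //; exact: (sadd_subr (submod_span _)).
apply: submodD => //; first exact: (sadd_subr (submod_span _)).
by apply: submodZ => //; apply: sadd_subl.
Qed.

(** By [koszul_exact_tail], x H^i(xs) = H^i(xs), so Nakayama gives H^i(xs) = 0. *)
Lemma koszul_exact_behead x (xs : seq R) i :
  noetherian R -> local_ring m -> m x ->
  koszul_exact (x :: xs) (setT : set R^o) [set 0] i.+1 ->
  koszul_exact xs (setT : set R^o) [set 0] i.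
Proof.
move=> noeth loc mx ex.
pose k := size xs.
(* Cochains are functions on all words, too large for finite generation; [res] and [ext] pass to and
   from words of length k, which are the only ones that matter. *)
pose ext (f : {ffun k.-tuple bool -> R^o}) (s : seq bool) : R^o :=
  if insub s is Some t then f t else 0.
pose res (c : seq bool -> R^o) : {ffun k.-tuple bool -> R^o} := [ffun t => c (val t)].
have extD f g s : ext (f + g) s = ext f s + ext g s.
  by rewrite /ext; case: insubP => [t _ _|_]; rewrite ?ffunE ?addr0.
have extZ a f s : ext (a *: f) s = a *: ext f s.
  by rewrite /ext; case: insubP => [t _ _|_]; rewrite ?ffunE ?scaler0.
have ext0 s : ext 0 s = 0.
  by rewrite /ext; case: insubP => [t _ _|_]; rewrite ?ffunE.
have resK c s : size s = k -> ext (res c) s = c s.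
  move=> sk; rewrite /ext; case: insubP => [t _ ts|]; first by rewrite ffunE ts.
  by rewrite sk eqxx.
have dres c s : size s = k -> koszul_d xs (ext (res c)) s = koszul_d xs c s.
  move=> sk; apply/eqP; rewrite -subr_eq0 -koszul_dB; apply/eqP.
  apply: (koszul_d_sub (@submod_set0 _ R^o)) => // t tk _.
  by rewrite /= resK // subrr.
pose Z := [set f | forall s, size s = k -> count id s = i.+1 ->
  koszul_d xs (ext f) s = 0].
pose B := [set f | exists b, forall s, size s = k -> count id s = i ->
  ext f s = koszul_d xs b s].
have hZ : submodule Z.
  apply: submodP.
  - move=> s _ _; rewrite (_ : ext 0 = fun=> 0) ?koszul_d0 //.
    by apply: funext => t; apply: ext0.
  - move=> f g hf hg s sk si; rewrite (_ : ext _ = fun t => ext f t + ext g t).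
      by rewrite koszul_dD hf // hg // addr0.
    by apply: funext => t; apply: extD.
  - move=> a f hf s sk si; rewrite (_ : ext _ = fun t => a *: ext f t).
      by rewrite koszul_dZ hf // scaler0.
    by apply: funext => t; apply: extZ.
have hB : submodule B.
  apply: submodP.
  - by exists (fun=> 0) => s _ _; rewrite koszul_d0 ext0.
  - move=> f g [b hb] [b' hb']; exists (fun t => b t + b' t) => s sk si.
    by rewrite koszul_dD extD hb // hb'.
  - move=> a f [b hb]; exists (fun t => a *: b t) => s sk si.
    by rewrite koszul_dZ extZ hb.
have [gs gsZ Zgs] := noetherian_ffun noeth hZ.
move=> c [_ zc].
have /(nakayama loc mx hB gsZ Zgs) : Z (res c).
  by move=> s sk si; rewrite dres //; apply: zc.
have step : forall f, Z f -> exists2 f', Z f' & B (f - x *: f').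
  move=> f Zf; have [||||c' [_ zc'] [b _ hb]] := @koszul_exact_tail _ R^o x xs setT [set 0] i (ext f).
  - exact: submodT.
  - exact: submod_set0.
  - exact: ex.
  - by split=> // s sk si; apply: Zf.
  exists (res c'); first by move=> s sk si; rewrite dres //; apply: zc'.
  exists (fun t => - b t) => s sk si; rewrite koszul_dN.
  rewrite -scaleNr extD extZ resK // scaleNr.
  by apply/eqP; rewrite -addr_eq0; apply/eqP; exact: hb.
move=> /(_ step)[b hb]; exists b => // s sk si.
by rewrite /= -hb // resK // subrr.
Qed.

(* Depth sensitivity of the Koszul complex, then Nakayama from the top down:
   any d elements generating an m-primary ideal of a local ring of depth at
   least d form a regular sequence. *)
Lemma regular_of_depth (ys xs : seq R) :
  noetherian R -> local_ring m -> weak_regular ys (setT : set R^o) [set 0] ->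
  [set` ys] `<=` m -> [set` xs] `<=` m -> m `<=` radical (ideal_of [set` xs]) ->
  size ys = size xs ->
  forall i, (i < size xs)%N -> forall a,
    ideal_of [set` take i xs] (a * xs`_i) -> ideal_of [set` take i xs] a.
Proof.
move=> noeth loc reg ym xm mJ sxy.
have revE (s : seq R) : [set` rev s] = [set` s].
  by rewrite eqEsubset; split=> a /=; rewrite mem_rev.
(* Descending in k from the full sequence. Prefixes are reversed so that shortening one removes the
   head of the list. *)
have ex k : (k <= size xs)%N -> forall i, (i < k)%N ->
    koszul_exact (rev (take k xs)) (setT : set R^o) [set 0] i.
  move=> ks; rewrite -(subKn ks); have := leq_subr k (size xs).
  elim: (size xs - k)%N => [_ i|j IH jx i ij].
    rewrite subn0 take_size -sxy => ik.
    apply: koszul_exact_depth ik => //; [exact: submodT|exact: submod_set0|].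
    by move=> f /ym/mJ; rewrite revE.
  move: ij; set k' := (size xs - j.+1)%N => ij.
  have kE : (size xs - j)%N = k'.+1 by rewrite /k'; lia.
  have lt : (k' < size xs)%N by rewrite /k'; lia.
  have := IH (ltnW jx) i.+1; rewrite kE (take_nth 0 lt) rev_rcons => /(_ ij).
  by apply: koszul_exact_behead => //; apply: xm; rewrite /= mem_nth.
move=> i ix a.
have E (s : seq R) : ideal_of [set` s] = seq_sub (rev s) (setT : set R^o) [set 0].
  rewrite eqEsubset; split.
    apply: ideal_of_sub; first exact: (@submod_seq_sub _ R^o _ _ _ (@submod_set0 _ R^o)).
    move=> b sb; apply: sadd_subl; first exact: (@submod_set0 _ R^o).
    by rewrite -[b]mulr1; apply: (@mem_smul _ R^o) => //; rewrite revE.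
  apply: (@sadd_sub _ R^o _ _ _ (ideal_ideal_of _)).
    apply: (@smul_sub _ R^o _ _ _ (ideal_ideal_of _)).
    move=> b v; rewrite revE => sb _; apply: (idealMr _ (ideal_ideal_of _)); exact: sub_ideal_of.
  by move=> _ ->; exact: (ideal0 (ideal_ideal_of _)).
rewrite !E mulrC => h.
apply: (@koszul_exact_top _ R^o (xs`_i)) => //; [exact: submodT|exact: submod_set0|].
rewrite -rev_rcons -take_nth // size_rev size_takel 1?ltnW //.
exact: ex.
Qed.

End Nakayama.

(** * Initial forms and the filtrations induced modulo (x_0, ..., x_(k-1)) *)

Section Filtration.
Variables (R : comNzRingType) (xs : seq R) (M : nat -> set R).
Implicit Types (a b r : R) (i j k n : nat).

Definition part_ideal k : set R := ideal_of [set` take k xs].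
Local Notation K := part_ideal.

Definition filt k n : set R := idadd (M n) (K k).
Local Notation F := filt.

(* For k < size xs: the initial form of x_k is a nonzerodivisor on the
   associated graded module of the filtration induced on R / (x_0, ..., x_(k-1)). *)
Definition initial_regular k := forall n a, F k n.+1 (a * xs`_k) -> F k n a.

Hypotheses (M_ideal : forall n, ideal (M n)) (M0 : M 0%N = setT).
Hypothesis M_decr : forall n, M n.+1 `<=` M n.
Hypothesis xM : forall x n a, x \in xs -> M n a -> M n.+1 (a * x).
Hypothesis x_regular : forall k, (k < size xs)%N ->
  forall a, K k (a * xs`_k) -> K k a.
Hypothesis x_superficial : forall k, (k < size xs)%N ->
  exists n0, forall n a, (n0 <= n)%N -> F k n.+1 (a * xs`_k) -> F k n a.

Lemma ideal_part k : ideal (K k).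
Proof. exact: ideal_ideal_of. Qed.

Lemma ideal_filt k n : ideal (F k n).
Proof. by apply: ideal_idadd => //; exact: ideal_part. Qed.

Lemma part_idealS k : (k < size xs)%N -> K k.+1 = scal_add setT xs`_k (K k).
Proof. by move=> kd; rewrite /K (take_nth 0) // ideal_of_rcons. Qed.

Lemma part_ideal_sub j k : (j <= k)%N -> K j `<=` K k.
Proof.
move=> jk; apply: ideal_of_mono => a /=; rewrite -(take_takel xs jk).
exact: mem_take.
Qed.

Lemma part_mulM k n a b : K k a -> M n b -> M n.+1 (a * b).
Proof.
move=> Ka Mb; have : colon (M n.+1) b a; last by [].
move: a Ka; apply: ideal_of_sub; first exact: ideal_colon.
by move=> a /= /mem_take ax; rewrite /colon /= mulrC; apply: xM.
Qed.

Lemma idmul_partM k n : idmul (K k) (M n) `<=` M n.+1.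
Proof. by apply: idmul_sub => // a b; apply: part_mulM. Qed.

Lemma part_filt k n : K k `<=` F k n.
Proof. exact: idadd_subr. Qed.

Lemma M_filt k n : M n `<=` F k n.
Proof. by apply: idadd_subl; exact: ideal_part. Qed.

Lemma filt0 k : F k 0%N = setT.
Proof.
by rewrite eqEsubset; split=> // a _; apply: M_filt; rewrite M0.
Qed.

Lemma filt_mul k n x a : x \in xs -> F k n a -> F k n.+1 (a * x).
Proof.
move=> xx [u Mu [v Kv <-]]; rewrite mulrDl; apply: (idealD (ideal_filt _ _)).
  by apply: M_filt; apply: xM.
by apply: part_filt; apply: (idealMr _ (ideal_part _)).
Qed.

Lemma filt_mulX k n j x a : x \in xs -> F k n a -> F k (n + j) (a * x ^+ j).
Proof.
move=> xx Fa; elim: j => [|j IH]; first by rewrite addn0 expr0 mulr1.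
by rewrite addnS exprSr mulrA; apply: filt_mul.
Qed.

Lemma filt_decr k n : F k n.+1 `<=` F k n.
Proof. by apply: idadd_mono. Qed.

Lemma filtS k n : (k < size xs)%N -> F k.+1 n = scal_add setT xs`_k (F k n).
Proof.
move=> kd; rewrite eqEsubset; split.
  apply: idadd_sub.
  - exact: ideal_scal_add idealT (ideal_filt _ _).
  - by apply: subset_trans (scal_add_subr _ idealT); exact: M_filt.
  - by rewrite part_idealS // => a [r _ h]; exists r => //; apply: part_filt.
apply: scal_add_sub; first exact: ideal_filt.
  move=> r _; apply: part_filt; rewrite part_idealS //.
  by apply: mem_scal_add => //; exact: ideal_part.
by apply: idadd_mono => //; exact: part_ideal_sub.
Qed.

(* The Sally machine: multiply a relation by a power of y large enough for
   the superficiality of x to apply, then divide by y on the quotient, where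
   its initial form is a nonzerodivisor. *)
Lemma initial_regular_descend k : (k.+1 < size xs)%N ->
  initial_regular k.+1 -> initial_regular k.
Proof.
move=> kd reg; have kd' : (k < size xs)%N by lia.
set y := xs`_k.+1; set x := xs`_k.
have yx : y \in xs by apply: mem_nth.
have xx : x \in xs by apply: mem_nth.
have regX j : forall n a, F k.+1 (n + j) (a * y ^+ j) -> F k.+1 n a.
  elim: j => [|j IH] n a; first by rewrite addn0 mulr1.
  by rewrite addnS exprSr mulrA => /reg; apply: IH.
have [n1 sup] := x_superficial kd'.
have lift n : forall j a, (n1 <= j)%N -> F k (n + j) (a * y ^+ j) -> F k n a.
  elim: n => [|n IH] j a nj; first by rewrite filt0.
  move=> Fa; have : F k.+1 n.+1 a.
    by apply: (regX j); move: Fa; apply: idadd_mono => //; exact: part_ideal_sub.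
  rewrite filtS // => -[r _ Fb].
  rewrite -(subrK (r * x) a); apply: (idealD (ideal_filt _ _)) => //.
  apply: filt_mul => //; apply: (IH j) => //; apply: sup; first by lia.
  rewrite -addSn (_ : _ * _ * _ = a * y ^+ j - (a - r * x) * y ^+ j); last by rewrite /x; ring.
  by apply: (idealB (ideal_filt _ _)) => //; apply: filt_mulX.
move=> n a Fa; apply: (lift n n1) => //; apply: sup; first by lia.
rewrite -addSn (_ : _ * _ * _ = a * x * y ^+ n1); last by rewrite /x; ring.
exact: filt_mulX.
Qed.

Lemma initial_regular_down k : (k < size xs)%N -> initial_regular k ->
  forall j, (j <= k)%N -> initial_regular j.
Proof.
move=> kd reg j jk; rewrite -(subKn jk); have := leq_subr j k.
elim: (k - j)%N => [|i IH] ik; first by rewrite subn0.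
apply: initial_regular_descend; first by lia.
by rewrite -subSn // subSS; apply: IH; exact: ltnW.
Qed.

(* One half of the Valabrega-Valla criterion. *)
Lemma initial_regular_part k : (k <= size xs)%N ->
  (forall j, (j < k)%N -> initial_regular j) ->
  forall n, K k `&` M n.+1 `<=` idmul (K k) (M n).
Proof.
elim: k => [|k IH] kd reg n a [Ka Ma].
  move: Ka; rewrite /K take0 ideal_of_nil => ->.
  exact: (ideal0 (ideal_idmul _ _)).
have [b _ Kb] : scal_add setT xs`_k (K k) a by rewrite -part_idealS.
have [u Mu [v Kv uvb]] : F k n b.
  apply: reg => //; rewrite -[b * _](subKr a) addrC.
  apply: (idealD (ideal_filt _ _)); last exact: M_filt.
  by apply: part_filt; apply: (idealN (ideal_part _)).
have Kx : K k.+1 xs`_k.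
  rewrite part_idealS // -[X in scal_add _ _ _ X]mul1r.
  by apply: mem_scal_add => //; exact: ideal_part.
rewrite -(subrK (xs`_k * u) a); apply: (idealD (ideal_idmul _ _)); last first.
  exact: mem_idmul Kx Mu.
have : idmul (K k) (M n) (a - xs`_k * u).
  apply: IH; [exact: ltnW|by move=> j jk; apply: reg; exact: ltnW|split].
    rewrite (_ : _ - _ = (a - b * xs`_k) + v * xs`_k); last by rewrite -uvb; ring.
    by apply: (idealD (ideal_part _)) => //; apply: (idealMr _ (ideal_part _)).
  apply: idealB => //; rewrite mulrC; apply: xM => //; exact: mem_nth.
by apply: idmul_mono => //; exact: part_ideal_sub.
Qed.

(** If a x_k = u + v with u in M_(n+1) and v in K_k, then u lies in K_(k+1), so u = b x_k modulo K_k
    with b in M_n; cancelling x_k modulo K_k gives a = b. *)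
Lemma part_initial_regular k : (k < size xs)%N ->
  (forall n, K k.+1 `&` M n.+1 `<=` scal_add (M n) xs`_k (K k)) ->
  initial_regular k.
Proof.
move=> kd h n a [u Mu [v Kv uv]].
have [|b Mb Kb] := h n u.
  split=> //; rewrite -(addrK v u) uv part_idealS //; exists a => //.
  by rewrite addrAC subrr add0r; apply: (idealN (ideal_part _)).
rewrite -(subrK b a); apply: (idealD (ideal_filt _ _)); last exact: M_filt.
apply: part_filt; apply: x_regular => //; rewrite mulrBl -uv.
rewrite addrAC; exact: (idealD (ideal_part _)).
Qed.

Lemma idmul_part_scal_add k n : (k < size xs)%N ->
  idmul (K k.+1) (M n) `<=` scal_add (M n) xs`_k (idmul (K k) (M n)).
Proof.
move=> kd; have iS := ideal_scal_add xs`_k (M_ideal n) (ideal_idmul (K k) (M n)).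
apply: idmul_sub => // a b; rewrite part_idealS // => -[r _ Ka] Mb.
exists (r * b); first exact: idealMl.
rewrite (_ : _ - _ = (a - r * xs`_k) * b); last by ring.
exact: mem_idmul.
Qed.

(** Write an element of K_k cap M_(n+1) as b x_k plus an element of K_k M_n, with b in M_n. Then b
    x_k is in K_k, so b is in K_k cap M_n, and induction on n applies to b. *)
Lemma part_descend k : (k < size xs)%N ->
  (forall n, K k `&` M n.+1 `<=` idmul (K k.+1) (M n)) ->
  forall n, K k `&` M n.+1 `<=` idmul (K k) (M n).
Proof.
move=> kd h; elim=> [|n IH] a [Ka Ma].
  by rewrite M0 idmulT //; exact: ideal_part.
have [b Mb Kw] := idmul_part_scal_add kd (h _ _ (conj Ka Ma)).
have KKw := idmul_subl (ideal_part k) Kw.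
rewrite -(subrK (b * xs`_k) a); apply: (idealD (ideal_idmul _ _)) => //.
have Kb : K k b.
  apply: x_regular => //; rewrite -[_ * _](subKr a).
  by apply: (idealB (ideal_part _)).
have := IH _ (conj Kb Mb).
have : ideal (colon (idmul (K k) (M n.+1)) xs`_k).
  by apply: ideal_colon; apply: ideal_idmul.
move=> /idmul_sub; apply=> u v Ku Mv; rewrite /colon /= -mulrA.
by apply: mem_idmul => //; apply: xM => //; apply: mem_nth.
Qed.

End Filtration.

(** Covers both normalisations of the statement: [hilbert_coefficients] uses D = d at n,
    [fiber_coefficients] uses D = d - 1 at n + 1. *)
Definition hilbert_poly (D : nat) (e : nat -> int) (n : nat) : int :=
  \sum_(i < D.+1) (-1) ^+ i * e i * ('C(n + D - 1 - i, D - i))%:Z.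

Lemma hilbert_polyS D e n : (0 < n)%N ->
  hilbert_poly D.+1 e n.+1 - hilbert_poly D.+1 e n = hilbert_poly D e n.+1.
Proof.
move=> n0; rewrite /hilbert_poly big_ord_recr [X in _ - X]big_ord_recr /=.
rewrite !subnn !bin0 opprD addrACA subrr addr0 -sumrB; apply: eq_bigr => i _.
rewrite -mulrBr; congr (_ * _); have hi := ltn_ord i.
have -> : (n.+1 + D.+1 - 1 - i = (n + D - i).+1)%N by lia.
have -> : (D.+1 - i = (D - i).+1)%N by lia.
have -> : (n + D.+1 - 1 - i = n + D - i)%N by lia.
have -> : (n.+1 + D - 1 - i = n + D - i)%N by lia.
by rewrite binS PoszD addrC addKr.
Qed.

(** * Hilbert functions and the one-dimensional quotient *)

Section Multiplicity.
Variables (R : comNzRingType) (m : set R).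
Hypotheses (noeth : noetherian R) (mmax : maximal_ideal m).
Variables (xs : seq R) (M : nat -> set R).
Implicit Types (i j k n : nat).

Local Notation K := (part_ideal xs).
Local Notation F := (filt xs M).

Hypotheses (M_ideal : forall n, ideal (M n)) (M0 : M 0%N = setT).
Hypothesis M_decr : forall n, M n.+1 `<=` M n.
Hypothesis xM : forall x n a, x \in xs -> M n a -> M n.+1 (a * x).
Hypothesis x_regular : forall k, (k < size xs)%N ->
  forall a, K k (a * xs`_k) -> K k a.
Hypothesis x_superficial : forall k, (k < size xs)%N ->
  exists n0, forall n a, (n0 <= n)%N -> F k n.+1 (a * xs`_k) -> F k n a.
Hypothesis M_mprimary : forall n, mprimary m (M n).
Hypothesis J_mprimary : mprimary m (K (size xs)).
Hypothesis M_reduction : exists n0, forall n, (n0 <= n)%N ->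
  M n.+1 `<=` idmul (K (size xs)) (M n).

Lemma mprimary_filt k n : mprimary m (F k n).
Proof. by apply: mprimary_idadd => //; exact: ideal_part. Qed.

(** For large n superficiality identifies F_k(n+1) : x_k with F_k(n). *)
Lemma colength_filtS k : (k < size xs)%N -> exists n0, forall n, (n0 <= n)%N ->
  colength (F k.+1 n.+1) = colength (F k n.+1) - colength (F k n).
Proof.
move=> kd; have [n0 sup] := x_superficial kd; exists n0 => n hn.
rewrite (colength_colon noeth mmax xs`_k (mprimary_filt k n.+1)) -filtS //.
rewrite (_ : colon _ _ = F k n) ?addrK // eqEsubset; split=> a.
  by apply: sup.
by apply: filt_mul => //; apply: mem_nth.
Qed.

(** Taking differences lowers both degrees by one and, by Pascal's rule, drops only the last
    coefficient of each polynomial. *)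
Lemma colength_filt_poly (e f : nat -> int) :
  (exists n0, forall n, (n0 <= n)%N -> colength (M n.+1) =
     hilbert_poly (size xs) e n + hilbert_poly (size xs).-1 f n.+1) ->
  forall k, (k < size xs)%N -> exists n0, forall n, (n0 <= n)%N ->
    colength (F k n.+1) =
    hilbert_poly (size xs - k) e n + hilbert_poly (size xs - k).-1 f n.+1.
Proof.
move=> hM; elim=> [|k IH] kd.
  have F0 n : F 0%N n = M n.
    apply: (@sadd_idr _ R^o _ _ (M_ideal n) (ideal_part xs 0)).
    by rewrite /part_ideal take0 ideal_of_nil => _ ->; exact: ideal0.
  by have [n0 h] := hM; exists n0 => n hn; rewrite F0 subn0 h.
have [n0 h0] := IH (ltnW kd); have [n1 h1] := colength_filtS (ltnW kd).
exists (n0 + n1 + 2)%N => -[|n] hn; first by lia.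
rewrite h1 ?h0; [|lia..].
have -> : (size xs - k = (size xs - k.+1).+1)%N by lia.
have -> : (size xs - k.+1 = (size xs - k.+1).-1.+1)%N by lia.
rewrite opprD addrACA !hilbert_polyS //; lia.
Qed.

(* Modulo (x_0, ..., x_(d-2)) the ring is one-dimensional, and drop_length n is
   there the length of M_(n+1) / x_(d-1) M_n. *)
Definition last_part n : set R :=
  scal_add (M n) xs`_(size xs).-1 (K (size xs).-1).

Definition drop_length n : int :=
  colength (M n.+1 `&` last_part n) - colength (M n.+1).

Hypothesis d_gt0 : (0 < size xs)%N.
Let k := (size xs).-1.

Let kd : (k < size xs)%N. Proof. by rewrite /k; lia. Qed.

Let KS : K (size xs) = scal_add setT xs`_k (K k).
Proof. by rewrite -part_idealS // /k prednK. Qed.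

Lemma ideal_last_part n : ideal (last_part n).
Proof. by apply: ideal_scal_add => //; exact: ideal_part. Qed.

Lemma idmul_sub_last_part n : idmul (K (size xs)) (M n) `<=` last_part n.
Proof.
have := @idmul_part_scal_add _ xs _ M_ideal k n kd.
rewrite /k prednK // => h; apply: (subset_trans h).
apply: scal_add_sub; first exact: ideal_last_part.
  by move=> r Mr; apply: mem_scal_add => //; exact: ideal_part.
apply: (subset_trans (idmul_subl (ideal_part _ _))).
exact: scal_add_subr.
Qed.

Lemma mprimary_last_part n : mprimary m (last_part n).
Proof.
apply: mprimary_sup (ideal_last_part n) (@idmul_sub_last_part n) _.
exact: mprimary_idmul.
Qed.

Lemma last_part_sub n : last_part n `<=` K (size xs).
Proof. by rewrite KS => a [r _ h]; exists r. Qed.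

Lemma idmul_sub_inter n : idmul (K (size xs)) (M n) `<=` M n.+1 `&` last_part n.
Proof.
move=> a h; split; last exact: idmul_sub_last_part.
by move: a h; apply: (idmul_partM M_ideal xM).
Qed.

(** Modular law for M_(n+1) and [last_part n]: their sum is F_k(n+1), and the colength of
    [last_part n] splits because x_k is regular modulo K_k. The right-hand side telescopes. *)
Lemma drop_lengthE n : drop_length n =
  colength (K (size xs)) + colength (F k n) - colength (F k n.+1).
Proof.
have e1 := colength_modular noeth mmax (M_mprimary n.+1) (mprimary_last_part n).
have lastE : last_part n = scal_add (F k n) xs`_k (K k).
  rewrite eqEsubset; split=> a [r].
    by move=> Mr h; exists r => //; apply: M_filt.
  move=> [u Mu [v Kv <-]] h; exists u => //.
  rewrite -/k (_ : _ - _ = (a - (u + v) * xs`_k) + v * xs`_k); last by ring.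
  by apply: (idealD (ideal_part _ _)) => //; apply: (idealMr _ (ideal_part _ _)).
have e2 : colength (last_part n) = colength (K (size xs)) + colength (F k n).
  rewrite lastE (colength_scal_add noeth mmax (mprimary_filt k n)) ?KS //.
  - exact: part_filt.
  - exact: ideal_part.
  - by rewrite -lastE; exact: mprimary_last_part.
  - by move=> a; apply: x_regular.
have e3 : idadd (M n.+1) (last_part n) = F k n.+1.
  rewrite eqEsubset; split.
    apply: idadd_sub; [exact: ideal_filt|exact: M_filt|].
    apply: scal_add_sub; [exact: ideal_filt| |exact: part_filt].
    by move=> r Mr; apply: M_filt; apply: xM => //; apply: mem_nth.
  by apply: idadd_mono => //; exact: scal_add_subr.
rewrite /drop_length; rewrite e2 e3 in e1.
rewrite (addrC (colength (K _))) addrC in e1 *.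
by move: e1; lia.
Qed.

Lemma sum_drop_length T : \sum_(n < T) drop_length n =
  T%:Z * colength (K (size xs)) - colength (F k T).
Proof.
elim: T => [|T IH]; first by rewrite big_ord0 (filt0 _ M0) colengthT mul0r subr0.
by rewrite big_ord_recr /= IH drop_lengthE -addn1 PoszD addn1; ring.
Qed.

Lemma drop_length_eventually0 : exists n0, forall n, (n0 <= n)%N -> drop_length n = 0.
Proof.
have [n0 h] := M_reduction; exists n0 => n hn; rewrite /drop_length.
rewrite (_ : _ `&` _ = M n.+1) ?subrr // eqEsubset; split=> [a []//|a Ma].
by apply: idmul_sub_inter; apply: h.
Qed.

(** In dimension one the colength of F_k(n+1) is e_0 n - e_1 + f_0 for large n; comparison with the
    telescoped sum gives both claims. *)
Lemma multiplicity_drop_length (e f : nat -> int) :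
  (exists n0, forall n, (n0 <= n)%N -> colength (M n.+1) =
     hilbert_poly (size xs) e n + hilbert_poly (size xs).-1 f n.+1) ->
  e 0%N = colength (K (size xs)) /\
  exists n0, forall T, (n0 <= T)%N ->
    \sum_(n < T) drop_length n = e 0%N + e 1%N - f 0%N.
Proof.
move=> /colength_filt_poly/(_ _ kd)[n0 h]; have [n1 v0] := drop_length_eventually0.
have {}h n : (n0 <= n)%N -> colength (F k n.+1) = e 0%N * n%:Z - e 1%N + f 0%N.
  move=> /h; rewrite (_ : (size xs - k = 1)%N); last by rewrite /k; lia.
  move=> ->; rewrite /hilbert_poly !big_ord_recr !big_ord0 /=.
  rewrite addn1 !subn1 !subn0 /= bin1 !bin0; ring.
have E n : (n0 <= n)%N -> \sum_(i < n.+1) drop_length i =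
    n.+1%:Z * colength (K (size xs)) - (e 0%N * n%:Z - e 1%N + f 0%N).
  by move=> hn; rewrite sum_drop_length h.
(* Two consecutive partial sums agree once [drop_length] vanishes, so the slopes e_0 and l(R/J)
   agree. *)
have e0 : e 0%N = colength (K (size xs)).
  have := E (n0 + n1).+1 (ltac:(lia)); rewrite big_ord_recr /= E ?v0; [|lia..].
  rewrite addr0 -(addn1 (n0 + n1).+1) -(addn1 (n0 + n1)) !PoszD.
  move=> /eqP; rewrite -subr_eq0 => /eqP h2; apply/eqP; rewrite -subr_eq0 -h2.
  apply/eqP; ring.
split=> //; exists n0.+1 => -[|T] hT //; rewrite E // -e0 -addn1 PoszD; ring.
Qed.

End Multiplicity.

(** * Depth of the associated graded module in terms of initial forms *)

Section GradedModule.
Import mpoly.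
Variables (R : comNzRingType) (I1 I2 : set R) (d : nat) (x : d.-tuple R).
Implicit Types (a b r : R) (i j k n : nat).

Local Notation M := (filtration I1 I2).
Local Notation K := (part_ideal x).
Local Notation F := (filt x M).
Local Notation V := (shift_module x).
Local Notation S := {mpoly R[d]}.
Local Notation num := (@graded_num R I1 I2 d x).
Local Notation den := (@graded_den R I1 I2 d x).
Local Notation C := (initial_regular x M).

Hypotheses (M_ideal : forall n, ideal (M n)).
Hypothesis M_decr : forall n, M n.+1 `<=` M n.
Hypothesis xM : forall y n a, y \in (x : seq R) -> M n a -> M n.+1 (a * y).
Hypothesis x_superficial : forall k, (k < d)%N ->
  exists n0, forall n a, (n0 <= n)%N -> F k n.+1 (a * x`_k) -> F k n a.
Hypothesis M1_proper : ~ idadd (M 1%N) (K d) 1.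

Let ideal_F k n : ideal (F k n). Proof. exact: ideal_filt. Qed.

Let coef (v : V) n : R := (v : {poly R})`_n.

Lemma coef_scaleX (i : 'I_d) (v : V) n :
  coef ('X_i *: v) n = if n is n'.+1 then coef v n' * x`_i else 0.
Proof.
rewrite /coef /GRing.scale /= /shift_scale /shift_eval mmapX mmap1U.
rewrite -scalerAl coefZ mulrC coefXM (tnth_nth 0).
by case: n => [|n]; rewrite ?mul0r.
Qed.

Definition monom a n : V := a *: 'X^n.

Lemma monomD a b n : monom (a + b) n = monom a n + monom b n.
Proof. by rewrite /monom scalerDl. Qed.

Lemma coef_monom a n j : coef (monom a n) j = if j == n then a else 0.
Proof. by rewrite /coef /monom coefZ coefXn; case: eqP; rewrite ?mulr1 ?mulr0. Qed.

(** The action is generated by constants and the x_i t, so stability under these two suffices. *)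
Lemma submod_coef (P : nat -> set R) : (forall n, ideal (P n)) ->
  (forall n a y, y \in (x : seq R) -> P n a -> P n.+1 (a * y)) ->
  submodule ([set v : V | forall n, P n (coef v n)] : set V).
Proof.
move=> hP xP; set T := (X in submodule X).
have T0 : T 0 by move=> n; rewrite /coef coef0; apply: ideal0.
have TD u v : T u -> T v -> T (u + v).
  by move=> Tu Tv n; rewrite /coef coefD; apply: idealD; [|apply: Tu|apply: Tv].
have TC c (v : V) : T v -> T (c%:P * (v : {poly R}) : {poly R}).
  by move=> Tv n; rewrite /coef coefCM; apply: idealMl; [|apply: Tv].
have TX (i : 'I_d) (v : V) : T v -> T ((tnth x i *: 'X) * (v : {poly R}) : {poly R}).
  move=> Tv n; rewrite /coef -scalerAl coefZ coefXM mulrC.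
  case: n => [|n] /=; first by rewrite mul0r; apply: ideal0.
  by apply: xP; [exact: mem_tnth|apply: Tv].
apply: submodP => // q v Tv.
rewrite /GRing.scale /= /shift_scale /shift_eval /mmap mulr_suml.
elim: (msupp q) => [|mn s IH]; first by rewrite big_nil.
rewrite big_cons; apply: TD => //; rewrite -mulrA; apply: TC.
rewrite /mmap1; elim: (index_enum _) => [|i r IH']; first by rewrite big_nil mul1r.
rewrite big_cons -mulrA; elim: (mn i) => [|l IHl]; first by rewrite expr0 mul1r.
by rewrite exprS -mulrA; apply: TX.
Qed.

Lemma submod_num : submodule num.
Proof. by apply: submod_coef => // n a y yx; apply: xM. Qed.

Lemma submod_den : submodule den.
Proof. by apply: (@submod_coef (fun n => M n.+1)) => // n a y yx; apply: xM. Qed.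

Lemma monom_num a n : M n a -> num (monom a n).
Proof.
move=> Ma j; rewrite -/(coef _ _) coef_monom; case: eqP => [->//|_].
exact: ideal0.
Qed.

Lemma monom_den a n : M n.+1 a -> den (monom a n).
Proof.
move=> Ma j; rewrite -/(coef _ _) coef_monom; case: eqP => [->//|_].
exact: ideal0.
Qed.

Definition vars : seq S := [seq 'X_i | i : 'I_d].

Lemma size_vars : size vars = d.
Proof. by rewrite size_image card_ord. Qed.

Lemma nth_vars (i : 'I_d) : vars`_i = 'X_i.
Proof. by rewrite /vars (nth_map i) ?size_enum_ord // nth_ord_enum. Qed.

Lemma mem_take_vars k (q : S) :
  q \in take k vars <-> exists2 i : 'I_d, (i < k)%N & q = 'X_i.
Proof.
split.
  move=> /(nthP 0)[i]; rewrite size_take_min size_vars leq_min => /andP[ik id] <-.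
  by exists (Ordinal id) => //; rewrite nth_take // -nth_vars.
move=> [i ik ->]; rewrite -nth_vars -(nth_take 0 ik) mem_nth //.
by rewrite size_take_min size_vars leq_min ik ltn_ord.
Qed.

Lemma ideal_of_vars : ideal_of [set` vars] = @var_ideal R d.
Proof.
rewrite /var_ideal; congr ideal_of; rewrite eqEsubset; split=> q /=.
  by rewrite -(take_size vars) => /mem_take_vars[i _ ->]; exists i.
by move=> [i _ <-]; rewrite -(take_size vars) mem_take_vars size_vars; exists i.
Qed.

Lemma seq_sub_vars_coef k v : seq_sub (take k vars) num den v ->
  forall n, F k n.+1 (coef v n).
Proof.
have hT : submodule ([set v : V | forall n, F k n.+1 (coef v n)] : set V).
  apply: (@submod_coef (fun n => F k n.+1)) => [n|n a y yx]; first exact: ideal_filt.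
  exact: filt_mul.
move: v; apply: (sadd_sub hT); last by move=> v Dv n; apply: M_filt; apply: Dv.
apply: (smul_sub hT) => q v /= /mem_take_vars[i ik ->] Nv n.
rewrite coef_scaleX; case: n => [|n]; first exact: (ideal0 (ideal_F _ _)).
apply: part_filt => //; apply: (idealMl _ (ideal_part _ _)).
apply: sub_ideal_of => /=; rewrite -(nth_take 0 ik) mem_nth //.
by rewrite size_take_min size_tuple leq_min ik ltn_ord.
Qed.

(** Converse of [seq_sub_vars_coef], by Valabrega-Valla: a coefficient in K_k cap M_n lies in K_k
    M_(n-1), so its monomial comes from X_1, ..., X_k. *)
Lemma coef_seq_sub_vars k v : (k <= d)%N -> (forall j, (j < k)%N -> C j) ->
  num v -> (forall n, F k n.+1 (coef v n)) -> seq_sub (take k vars) num den v.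
Proof.
move=> kd reg Nv Fv.
have hQ := submod_seq_sub (take k vars) num submod_den.
have hs := submod_smul [set` take k vars] num.
have VV : forall n, K k `&` M n.+1 `<=` idmul (K k) (M n).
  by apply: initial_regular_part => //; rewrite size_tuple.
have mono n : seq_sub (take k vars) num den (monom (coef v n) n).
  have [a Ma [b Kb ab]] := Fv n.
  have -> : monom (coef v n) n = monom b n + monom a n.
    by rewrite -monomD addrC ab.
  apply: (submodD hQ); last by apply: (sadd_subr hs); apply: monom_den.
  have {Ma ab} Mb : M n b.
    rewrite (_ : b = coef v n - a); last by rewrite -ab addrC addKr.
    by apply: (idealB (M_ideal n)); [apply: Nv|apply: M_decr].
  (* In degree 0 there is nothing to divide by a variable, but K_k lies in M_1, so the monomial is
     already zero in G(M). *)
  case: n Mb => [|n] Mb.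
    apply: (sadd_subr hs); apply: monom_den; rewrite -[b]mulr1.
    exact: (part_mulM M_ideal xM Kb).
  apply: (sadd_subl submod_den).
  have hI (c : {poly R}) : ideal [set b | smul [set` take k vars] num (monom b n.+1)].
    apply: ideal_intro => [|a1 a2 h1 h2|a1 a2 h1] /=.
    - by rewrite /monom scale0r; exact: (submod0 hs).
    - by rewrite monomD; exact: (submodD hs h1 h2).
    - have := submodZ (a1%:MP) hs h1.
      rewrite /GRing.scale /= /shift_scale /shift_eval mmapC /monom mul_polyC.
      by rewrite scalerA.
  have := VV _ _ (conj Kb Mb); move: b {Kb Mb}.
  apply: (idmul_sub (hI 0)) => a1 b Ka; move: a1 Ka b.
  have : ideal [set a1 | forall b, M n b -> smul [set` take k vars] num (monom (a1 * b) n.+1)].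
    apply: ideal_intro => /= [b|u w hu hw b Mb|u w hw b Mb].
    - by move=> _; rewrite mul0r; exact: (ideal0 (hI 0)).
    - by rewrite mulrDl; exact: (idealD (hI 0) (hu _ Mb) (hw _ Mb)).
    - by rewrite -mulrA; exact: (idealMl _ (hI 0) (hw _ Mb)).
  move=> /ideal_of_sub; apply=> y /= yk b Mb.
  have [i ik yi] : exists2 i, (i < k)%N & y = x`_i.
    move/(nthP 0): yk => [i]; rewrite size_take_min size_tuple leq_min.
    by move=> /andP[ik id] <-; exists i => //; rewrite nth_take.
  have id : (i < d)%N by exact: leq_trans ik kd.
  have -> : monom (y * b) n.+1 = 'X_(Ordinal id) *: monom b n.
    apply/polyP => j; rewrite -!/(coef _ _) coef_monom coef_scaleX.
    case: j => [|j] //; rewrite eqSS coef_monom yi.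
    by case: eqP => _; rewrite ?mul0r // mulrC.
  apply: mem_smul; last exact: monom_num.
  by apply/mem_take_vars; exists (Ordinal id).
have -> : v = \sum_(n < size (v : {poly R})) monom (coef v n) n :> V.
  by rewrite -[LHS](coefK (v : {poly R})) poly_def.
exact: submod_sum.
Qed.

Lemma weak_regular_vars k : (k <= d)%N -> (forall j, (j < k)%N -> C j) ->
  weak_regular (take k vars) num den.
Proof.
move=> kd reg i; rewrite size_take_min size_vars leq_min => /andP[ik id] v Nv.
rewrite take_takel ?(ltnW ik) // nth_take // -[i]/(val (Ordinal id)) nth_vars.
move=> /seq_sub_vars_coef h; apply: coef_seq_sub_vars => //; first exact: ltnW.
  by move=> j ji; apply: reg; exact: ltn_trans ji ik.
by move=> n; apply: (reg _ ik); have := h n.+1; rewrite coef_scaleX.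
Qed.

Lemma filt_anti k i j : (i <= j)%N -> F k j `<=` F k i.
Proof.
move=> ij; rewrite -(subnK ij); elim: (j - i)%N => [|l IH] //.
by rewrite addSn; apply: subset_trans IH; apply: filt_decr.
Qed.

Hypothesis M0 : M 0%N = setT.

(** The sequence fs gives exactness in more than k degrees and X_1, ..., X_k use up k of them, so
    degree 0 survives. *)
Lemma koszul_exact_vars (fs : seq S) k : (k <= d)%N -> (forall j, (j < k)%N -> C j) ->
  [set` fs] `<=` @var_ideal R d -> weak_regular fs num den -> (k < size fs)%N ->
  koszul_exact vars num (seq_sub (take k vars) num den) 0.
Proof.
move=> kd reg fsA regf kfs.
apply: (koszul_exact_section submod_num submod_den (weak_regular_vars kd reg)) (size fs) _ _ _.
  apply: (koszul_exact_depth submod_num submod_den regf) => f ffs.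
  by exists 1%N; rewrite expr1 ideal_of_vars; apply: fsA.
by rewrite size_take_min size_vars addn0 (minn_idPl kd).
Qed.

(** Modulo the earlier variables, let p of degree n be killed by the next one. Every X_j p is killed
    too and has degree n + 1, so it vanishes by descending induction; then p lies in H^0 and
    vanishes. *)
Lemma initial_regular_of_depth (fs : seq S) :
  [set` fs] `<=` @var_ideal R d -> weak_regular fs num den ->
  forall i, (i < d)%N -> (i < size fs)%N -> C i.
Proof.
move=> fsA regf; elim/ltn_ind => i IH id ifs.
have reg j : (j < i)%N -> C j.
  by move=> ji; apply: IH => //; exact: ltn_trans ji _.
have ex := koszul_exact_vars (ltnW id) reg fsA regf ifs.
have hQ := submod_seq_sub (take i vars) num submod_den.
have [n1 sup] := x_superficial id.
(* Here l measures how far n is below the degrees where superficiality settles the claim. *)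
have hom l : forall n p, (n1 <= n + l)%N -> M n p -> F i n.+2 (p * x`_i) -> F i n.+1 p.
  elim: l => [|l IHl] n p hn Mp Fp; first by apply: sup => //; lia.
  suff : seq_sub (take i vars) num den (monom p n).
    by move=> /seq_sub_vars_coef/(_ n); rewrite coef_monom eqxx.
  apply: (koszul_exact0 submod_num hQ ex); first exact: monom_num.
  move=> q qv; have /mem_take_vars[j _ ->] : q \in take (size vars) vars by rewrite take_size.
  have xj : x`_j \in (x : seq R) by rewrite mem_nth // size_tuple.
  apply: coef_seq_sub_vars => //; first exact: ltnW.
    by apply: (submodZ _ submod_num); exact: monom_num.
  move=> n'; rewrite coef_scaleX; case: n' => [|n'].
    exact: (ideal0 (ideal_F _ _)).
  rewrite coef_monom; case: eqP => [->|_]; last first.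
    by rewrite mul0r; exact: (ideal0 (ideal_F _ _)).
  apply: IHl; [lia|exact: xM|].
  by rewrite mulrAC; apply: filt_mul.
(* The order of a is raised one step at a time, the homogeneous claim [hom] being applied to its
   current leading part u. *)
move=> n a Fa; suff h j : (j <= n)%N -> F i j a by apply: h.
elim: j => [|j IHj] jn; first by rewrite filt0.
have [u Mu [v Kv uv]] := IHj (ltnW jn).
rewrite -uv; apply: (idealD (ideal_F _ _)) => //; last exact: part_filt.
apply: (hom n1) => //; first lia.
rewrite (_ : u * _ = a * x`_i - v * x`_i); last by rewrite -uv; ring.
apply: (idealB (ideal_F _ _)) => //; first by apply: filt_anti Fa; lia.
by apply: part_filt => //; apply: (idealMr _ (ideal_part _ _)).
Qed.

Lemma one_notin_seq_sub k : (k <= d)%N -> ~ seq_sub (take k vars) num den (monom 1 0).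
Proof.
move=> kd /seq_sub_vars_coef/(_ 0%N); rewrite coef_monom eqxx => h; apply: M1_proper.
by move: h; apply: idadd_mono => //; exact: part_ideal_sub.
Qed.

Lemma one_num : num (monom 1 0).
Proof. by apply: monom_num; rewrite M0. Qed.

(** A longer sequence would make H^0 of G(M) / (X_1, ..., X_d) G(M) vanish, yet the class of 1 is
    nonzero there and killed by all variables. *)
Lemma weak_regular_size (fs : seq S) :
  [set` fs] `<=` @var_ideal R d -> weak_regular fs num den -> (size fs <= d)%N.
Proof.
move=> fsA regf; rewrite leqNgt; apply/negP => dfs.
have reg j : (j < d)%N -> C j.
  by move=> jd; apply: initial_regular_of_depth regf _ _ _ => //; exact: ltn_trans dfs.
apply: (one_notin_seq_sub (leqnn d)).
apply: (koszul_exact0 submod_num _ (koszul_exact_vars (leqnn d) reg fsA regf dfs)).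
- exact: submod_seq_sub submod_den.
- exact: one_num.
move=> q qv; apply: sadd_subl; first exact: submod_den.
apply: mem_smul; last exact: one_num.
by rewrite /= take_oversize ?size_vars.
Qed.

Lemma graded_depth_regular k : graded_depth I1 I2 x k ->
  forall i, (i < d)%N -> (i < k)%N -> C i.
Proof.
by move=> [fs [fsA [regf _] _ <-]]; apply: initial_regular_of_depth regf.
Qed.

Lemma regular_seq_vars k : (k <= d)%N -> (forall j, (j < k)%N -> C j) ->
  regular_seq (take k vars) num den.
Proof.
move=> kd reg; split; first exact: weak_regular_vars.
by move=> e; apply: (one_notin_seq_sub kd); rewrite /seq_sub e; exact: one_num.
Qed.

Lemma take_vars_sub k : [set` take k vars] `<=` @var_ideal R d.
Proof.
by rewrite -ideal_of_vars => q /mem_take qv; apply: sub_ideal_of.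
Qed.

(** [has_depth] asks for a maximal sequence. With d <= k + 1, the sequence X_1, ..., X_k is maximal
    or becomes so after one extension, because lengths are bounded by d. *)
Lemma regular_graded_depth k : (d <= k.+1)%N -> (k <= d)%N ->
  (forall j, (j < k)%N -> C j) ->
  exists2 k', graded_depth I1 I2 x k' & (k <= k')%N.
Proof.
move=> dk kd reg; have regk := regular_seq_vars kd reg.
have sk : size (take k vars) = k by rewrite size_take_min size_vars (minn_idPl kd).
have [mx|/existsNP[f /not_implyP[fA /contrapT regf]]] :=
    pselect (forall f, @var_ideal R d f -> ~ regular_seq (rcons (take k vars) f) num den).
  exists k => //; exists (take k vars); split=> //; exact: take_vars_sub.
have fsA : [set` rcons (take k vars) f] `<=` @var_ideal R d.
  by move=> q /=; rewrite mem_rcons inE => /predU1P[->//|]; exact: take_vars_sub.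
exists k.+1 => //; exists (rcons (take k vars) f); split=> //; last by rewrite size_rcons sk.
move=> g gA [regg _].
have : (size (rcons (rcons (take k vars) f) g) <= d)%N.
  apply: weak_regular_size regg => q /=; rewrite mem_rcons inE => /predU1P[->//|].
  exact: fsA.
rewrite !size_rcons sk; lia.
Qed.

Lemma graded_depthE k : (d <= k.+1)%N -> (k <= d)%N ->
  (exists2 k', graded_depth I1 I2 x k' & (k <= k')%N) <->
  (forall j, (j < k)%N -> C j).
Proof.
move=> dk kd; split; last exact: regular_graded_depth.
move=> [k' hk' kk'] j jk; apply: (graded_depth_regular hk').
  exact: leq_trans jk kd.
exact: leq_trans jk kk'.
Qed.

Lemma graded_cohen_macaulayE : graded_cohen_macaulay I1 I2 x <->
  (forall j, (j < d)%N -> C j).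
Proof.
rewrite -(graded_depthE (leqnSn d) (leqnn d)); split; first by exists d.
move=> [k [fs [fsA [regf nT] mx sfs]] dk].
have := weak_regular_size fsA regf; rewrite sfs => kd.
by exists fs; split=> //; rewrite sfs; apply/eqP; rewrite eqn_leq kd.
Qed.

End GradedModule.

(** * Colength of J I for a regular sequence generating J *)

Section RegularSequenceColength.
Variables (R : comNzRingType) (m : set R) (xs : seq R) (I : set R).
Hypotheses (noeth : noetherian R) (mmax : maximal_ideal m).
Local Notation K := (part_ideal xs).
Hypothesis x_regular : forall k, (k < size xs)%N ->
  forall a, K k (a * xs`_k) -> K k a.
Hypotheses (mI : mprimary m I) (mJ : mprimary m (K (size xs))).
Hypothesis JI : K (size xs) `<=` I.

Let iI : ideal I. Proof. by case: mI. Qed.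

(** Generators of J beyond x_k are eliminated from the last one down: the coefficient b of x_j lies
    in K_j by regularity, and x_j lies in I, so b x_j is absorbed into K_j I. *)
Lemma colon_part_idmul k a : (k < size xs)%N ->
  idadd (K k) (idmul (K (size xs)) I) (a * xs`_k) -> I a.
Proof.
move=> kd; suff h j : (k < j)%N -> (j <= size xs)%N ->
    idadd (K k) (idmul (K j) I) (a * xs`_k) -> I a by exact: h.
have KI i : (i <= size xs)%N -> K i `<=` I.
  by move=> id; apply: subset_trans JI; apply: part_ideal_sub.
elim: j => // j IH; rewrite ltnS => kj jd [u Ku [w Jw uw]].
have [b Ib Kb] := @idmul_part_scal_add _ xs (fun=> I) (fun=> iI) j 0%N jd _ Jw.
move: kj; rewrite leq_eqVlt => /predU1P[kE|kj].
  rewrite -kE in Jw Kb; rewrite -(subrK b a); apply: idealD => //.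
  apply: (KI k); first exact: ltnW.
  apply: x_regular => //; rewrite mulrBl -uw -addrA.
  apply: (idealD (ideal_part _ _)) => //.
  exact: (idmul_subl (ideal_part _ _) Kb).
apply: IH => //; first exact: ltnW.
exists u => //; exists w => //.
rewrite -(subrK (b * xs`_j) w); apply: (idealD (ideal_idmul _ _)) => //.
have Kjb : K j b.
  apply: x_regular => //.
  have -> : b * xs`_j = (a * xs`_k - u) - (w - b * xs`_j) by rewrite -uw; ring.
  apply: (idealB (ideal_part _ _)); last exact: (idmul_subl (ideal_part _ _) Kb).
  apply: (idealB (ideal_part _ _)).
    apply: (part_ideal_sub kj); rewrite part_idealS //.
    by apply: mem_scal_add => //; exact: ideal_part.
  exact: (part_ideal_sub (ltnW kj)).
apply: mem_idmul => //; apply: JI; apply: sub_ideal_of.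
by rewrite /= take_size mem_nth.
Qed.

(** J / J I is free of rank d over R / I: each x_k added to J I lowers the colength by l(R/I). *)
Lemma colength_part_idmul :
  colength (idmul (K (size xs)) I) =
  colength (K (size xs)) + (size xs)%:Z * colength I.
Proof.
set JI1 := idmul _ _; have iJI : ideal JI1 by exact: ideal_idmul.
have mJI : mprimary m JI1 by apply: mprimary_idmul.
have h k : (k <= size xs)%N ->
    colength JI1 = colength (idadd (K k) JI1) + k%:Z * colength I.
  elim: k => [|k IH] kd.
    rewrite mul0r addr0; congr colength; rewrite eqEsubset; split.
      by apply: idadd_subr; exact: ideal_part.
    apply: idadd_sub => //; rewrite /part_ideal take0 ideal_of_nil => _ ->.
    exact: ideal0.
  have iL j : ideal (idadd (K j) JI1) by apply: ideal_idadd => //; exact: ideal_part.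
  have mL : mprimary m (idadd (K k) JI1).
    by apply: mprimary_sup mJI => //; apply: idadd_subr; exact: ideal_part.
  rewrite IH ?(ltnW kd) // (colength_colon noeth mmax xs`_k mL).
  have -> : colon (idadd (K k) JI1) xs`_k = I.
    rewrite eqEsubset; split=> a; first exact: colon_part_idmul.
    move=> Ia; rewrite /colon /= mulrC; apply: idadd_subr; first exact: ideal_part.
    apply: mem_idmul => //; apply: sub_ideal_of.
    by rewrite /= take_size mem_nth.
  have -> : scal_add setT xs`_k (idadd (K k) JI1) = idadd (K k.+1) JI1.
    rewrite eqEsubset; split.
      apply: scal_add_sub => //.
        move=> r _; apply: idadd_subl => //; rewrite part_idealS //.
        by apply: mem_scal_add => //; exact: ideal_part.
      by apply: idadd_mono => //; exact: part_ideal_sub.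
    apply: idadd_sub; first exact: ideal_scal_add idealT (iL _).
      rewrite part_idealS // => a [r _ h]; exists r => //.
      exact: (idadd_subl iJI).
    apply: (subset_trans _ (scal_add_subr _ idealT)).
    by apply: idadd_subr; exact: ideal_part.
  by rewrite -(addn1 k) PoszD; ring.
rewrite (h _ (leqnn _)); congr (colength _ + _); rewrite eqEsubset; split.
  apply: idadd_sub => //; [exact: ideal_part|exact: idmul_subl (ideal_part _ _)].
exact: idadd_subl.
Qed.

End RegularSequenceColength.

(** * The two equality conditions as regularity of initial forms *)

Section EqualityCases.
Variables (R : comNzRingType) (m : set R) (xs : seq R) (M : nat -> set R).
Implicit Types (j k n : nat).

Local Notation K := (part_ideal xs).
Local Notation F := (filt xs M).
Local Notation d := (size xs).

Hypotheses (M_ideal : forall n, ideal (M n)) (M0 : M 0%N = setT).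
Hypothesis M_decr : forall n, M n.+1 `<=` M n.
Hypothesis xM : forall x n a, x \in xs -> M n a -> M n.+1 (a * x).
Hypothesis x_regular : forall k, (k < size xs)%N ->
  forall a, K k (a * xs`_k) -> K k a.
Hypothesis x_superficial : forall k, (k < size xs)%N ->
  exists n0, forall n a, (n0 <= n)%N -> F k n.+1 (a * xs`_k) -> F k n a.
Hypothesis d_gt0 : (0 < d)%N.

(** The left side says that every [drop_length n] attains its lower estimate, the length of M_(n+1)
    / (J cap M_(n+1)). *)
Lemma initial_regular_all :
  (forall n, K d `&` M n.+1 `<=` last_part xs M n) <->
  (forall j, (j < d)%N -> initial_regular xs M j).
Proof.
have kd : (d.-1 < d)%N by rewrite prednK.
split=> [h j jd|reg n a h].
  have regd : initial_regular xs M d.-1.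
    by apply: (part_initial_regular M_ideal x_regular kd); rewrite prednK.
  apply: (initial_regular_down M_ideal M0 xM x_superficial kd regd); lia.
apply: (idmul_sub_last_part M_ideal d_gt0).
exact: (initial_regular_part M_ideal xM (leqnn _) reg h).
Qed.

(** The left side says that every [drop_length n] attains its upper estimate. As K_(d-1) lies in
    [last_part n], it gives the hypothesis of [part_descend] at k = d - 1. *)
Lemma initial_regular_but_last : (1 < d)%N ->
  (forall n, M n.+1 `&` last_part xs M n = idmul (K d) (M n)) <->
  (forall j, (j < d.-1)%N -> initial_regular xs M j).
Proof.
move=> d1; have kd : (d.-1 < d)%N by rewrite prednK.
have kd' : (d.-2 < d)%N by lia.
have pE : (d.-2.+1 = d.-1)%N by lia.
split=> [h j jd|reg n].
  suff regd : initial_regular xs M d.-2.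
    apply: (initial_regular_down M_ideal M0 xM x_superficial kd' regd); lia.
  have VV : forall n, K d.-1 `&` M n.+1 `<=` idmul (K d.-1) (M n).
    apply: (part_descend M_ideal M0 xM x_regular kd) => n a [Ka Ma].
    by rewrite prednK // -h; split=> //; apply: scal_add_subr.
  apply: (part_initial_regular M_ideal x_regular kd') => n; rewrite pE; apply: (subset_trans (VV n)).
  rewrite -pE; apply: (subset_trans (idmul_part_scal_add M_ideal kd')).
  move=> a [r Mr h']; exists r => //.
  exact: (idmul_subl (ideal_part _ _) h').
rewrite eqEsubset; split; last exact: idmul_sub_inter.
move=> a [Ma [b Mb Kb]].
have xK : K d xs`_d.-1.
  by apply: sub_ideal_of; rewrite /= take_size mem_nth.
rewrite -(subrK (b * xs`_d.-1) a); apply: (idealD (ideal_idmul _ _)).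
  have : idmul (K d.-1) (M n) (a - b * xs`_d.-1).
    apply: (initial_regular_part M_ideal xM (ltnW kd) reg).
    by split=> //; apply: idealB => //; apply: xM => //; apply: mem_nth.
  by apply: idmul_mono => //; apply: part_ideal_sub; exact: ltnW.
by rewrite mulrC; apply: mem_idmul.
Qed.

End EqualityCases.

(** * Sums of nonnegative terms, and the two bounds *)

Lemma fsbig_tail2 (F : nat -> int) N : (forall n, (N.+2 <= n)%N -> F n = 0) ->
  \sum_(n \in [set n : nat | (2 <= n)%N]) F n = \sum_(i < N) F i.+2.
Proof.
move=> F0; pose F' n := if (2 <= n)%N then F n else 0.
transitivity (\sum_(n \in [set n : nat | (2 <= n)%N]) F' n).
  by apply: eq_fsbigr => n; rewrite inE /F' => ->.
transitivity (\sum_(n \in `I_N.+2) F' n); last first.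
  by rewrite -fsbig_ord !big_ord_recl /= !add0r; apply: eq_bigr.
transitivity (\sum_(n \in [set: nat]) F' n).
  apply: fsbig_widen => // n [_ /= n2]; rewrite /F'; case: ifP => // h.
apply: esym; apply: fsbig_widen => // n [_ /= hn]; rewrite /F'.
by case: ifP => // _; apply: F0; rewrite leqNgt; apply/negP.
Qed.

Lemma sumr_ord_eq0 (v : nat -> int) n0 : (forall n, 0 <= v n) ->
  (forall T, (n0 <= T)%N -> \sum_(n < T) v n = 0) -> forall n, v n = 0.
Proof.
move=> v0 s0 n; have := s0 (n0 + n.+1)%N (leq_addr _ _).
have lt : (n < n0 + n.+1)%N by lia.
by move=> /psumr_eq0P => /(_ (fun i _ => v0 i))/(_ (Ordinal lt) isT).
Qed.

Lemma proper_ideal_sub_max (R : comNzRingType) (m I : set R) :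
  local_ring m -> ideal I -> I <> setT -> I `<=` m.
Proof.
move=> loc hI IT a Ia; apply: contrapT => /(local_inv loc)[v va].
by apply: IT; apply: ideal_eqT => //; rewrite -va; exact: (idealMl _ hI Ia).
Qed.

Theorem corollary6p4 (R : comNzRingType) (m : set R) (d : nat)
    (I1 I2 : set R) (x : d.-tuple R) (e f : nat -> int)
    (J := ideal_of [set` x]) :
  cohen_macaulay_local m d -> (2 <= d)%N -> infinite_residue_field m ->
  primary_ideal I1 -> radical I1 = m ->
  primary_ideal I2 -> radical I2 = m ->
  minimal_reduction J I2 -> superficial_seq I2 I1 x ->
  J `<=` I1 -> J `&` idmul I1 I2 = idmul J I1 ->
  hilbert_coefficients d I2 e -> fiber_coefficients d I1 I2 f ->
  (let upper := e 1%N - e 0%N + (idlength I2 (idmul I1 I2))%:Z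
                + (idlength setT I2)%:Z
                - (d%:Z - 1) * (idlength setT I1)%:Z in
   f 0%N <= upper /\
   (f 0%N = upper <->
    graded_cohen_macaulay I1 I2 x /\
    forall n, (2 <= n)%N -> idadd (idmul I1 (idexp I2 n)) J = J))
  /\
  (let lower := e 1%N - (idlength (idmul I1 I2) (idmul J I1))%:Z
                - \sum_(n \in [set n : nat | (2 <= n)%N])
                    (idlength (idmul I1 (idexp I2 n))
                       (idmul J (idmul I1 (idexp I2 n.-1))))%:Z
                + (idlength setT I1)%:Z in
   lower <= f 0%N /\
   (f 0%N = lower <->
    exists2 k, graded_depth I1 I2 x k & (d - 1 <= k)%N)).
Proof.
move=> [noeth loc _ [ys [ysm [yreg _] _ sys]]] d2 _.
move=> [iI1 I1T _] rI1 [iI2 I2T _] rI2 [[iJ JI2 [r Jr]] _] [xI2 xsup] JI1 JI12 he hf.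
have mmax : maximal_ideal m by apply/loc.
have mI1 : mprimary m I1 by split=> //; rewrite rI1.
have mI2 : mprimary m I2 by split=> //; rewrite rI2.
have mE n := mprimary_idexp n mI2.
have iE n : ideal (idexp I2 n) by case: (mE n).
have mJ : mprimary m J.
  apply: (mprimary_sup iJ _ (mE r.+1)); rewrite Jr; exact: idmul_subl.
have sx : size x = d by rewrite size_tuple.
pose M := filtration I1 I2.
have M_ideal n : ideal (M n) by case: n => [|n]; [exact: idealT|exact: ideal_idmul].
have mM n : mprimary m (M n).
  by case: n => [|n]; [exact: mprimaryT|exact: mprimary_idmul].
have M0 : M 0%N = setT by [].
have M_decr n : M n.+1 `<=` M n.
  by case: n => [|n] //; apply: idmul_mono => //; exact: idmul_subr.
have xJ y : y \in (x : seq R) -> J y by move=> yx; exact: (@sub_ideal_of _ [set` x] y yx).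
(* From M_0 = R to M_1 = I1 this is J [<=] I1; above, J [<=] I2 raises the power of I2. *)
have xM y n a : y \in (x : seq R) -> M n a -> M n.+1 (a * y).
  move=> yx; case: n => [_|n Ma]; rewrite mulrC.
    by apply: mem_idmul => //; apply: JI1; exact: xJ.
  by rewrite /M /= idmulCA; apply: mem_idmul => //; apply: JI2; exact: xJ.
have Kd : part_ideal x d = J by rewrite /part_ideal take_oversize ?sx.
have xreg k : (k < size x)%N -> forall a,
    part_ideal x k (a * x`_k) -> part_ideal x k a.
  move=> kd a; apply: (@regular_of_depth _ m ys) => //; last by rewrite sys sx.
    by move=> y /xJ /JI2; apply: proper_ideal_sub_max.
  by case: mJ.
have xsup' k : (k < size x)%N -> exists n0, forall n a, (n0 <= n)%N ->
    filt x M k n.+1 (a * x`_k) -> filt x M k n a.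
  move=> kd; have [_ [r0 r00 h]] := xsup k kd; exists r0 => -[|n] a hn; first by lia.
  (* With s = 1 and r = n + 1, superficiality says that (x_k) cap M_(n+2) is x_k M_(n+1) modulo K_k;
     regularity of x_k modulo K_k then cancels x_k. *)
  have {h} := h n.+1 1%N hn; rewrite /= idmulT // => h Fa.
  have : idadd (idmul (ideal_of [set x`_k]) (idmul I1 (idexp I2 n))) (part_ideal x k) (a * x`_k).
    rewrite /part_ideal -h; split=> //; apply: idadd_subl; first exact: ideal_ideal_of.
    by apply/ideal_of_set1; exists a.
  move=> [u uI [v Kv uv]].
  have [b Mb ub] : exists2 b, M n.+1 b & u = b * x`_k.
    have : scal_add (M n.+1) x`_k [set 0] u.
      move: u uI {uv}; apply: idmul_sub.
        by exact: (ideal_scal_add _ (M_ideal n.+1) ideal_set0).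
      move=> y b /ideal_of_set1[t ->] Mb; exists (t * b); first exact: (idealMl _ (M_ideal n.+1) Mb).
      by rewrite /= mulrAC subrr.
    by move=> [b Mb /eqP]; rewrite subr_eq0 => /eqP ub; exists b.
  exists b => //; exists (a - b); last by rewrite addrC subrK.
  by apply: xreg => //; rewrite mulrBl -uv -ub addrAC subrr add0r.
have Mred n : (r <= n)%N -> idexp I2 n.+1 = idmul J (idexp I2 n).
  move=> rn; rewrite -(subnK rn); elim: (n - r)%N => [//|i IH].
  transitivity (idmul I2 (idmul J (idexp I2 (i + r)))); first by rewrite -IH.
  exact: idmulCA.
have M_red : exists n0, forall n, (n0 <= n)%N -> M n.+1 `<=` idmul (part_ideal x (size x)) (M n).
  exists r.+1 => -[|n] // rn; rewrite sx Kd.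
  by rewrite (_ : M n.+2 = idmul I1 (idexp I2 n.+1)) // Mred // idmulCA.
have M1 : M 1%N = I1 by rewrite /M /= idmulT.
have M2 : M 2%N = idmul I1 I2 by rewrite /M /= idmulT.
have M1p : ~ idadd (M 1%N) (part_ideal x d) 1.
  rewrite M1 Kd => h; apply: I1T; apply: ideal_eqT => //.
  by move: h; apply: idadd_sub.
have d0 : (0 < size x)%N by rewrite sx; exact: ltnW.
have hM : exists n0, forall n, (n0 <= n)%N -> colength (M n.+1) =
    hilbert_poly (size x) e n + hilbert_poly (size x).-1 f n.+1.
  have [n0 {}he] := he; have [n1 {}hf] := hf; exists (n0 + n1)%N => n hn.
  rewrite sx -(subrK (colength (idexp I2 n)) (colength (M n.+1))) addrC.
  rewrite -(idlengthE noeth mmax) //; last exact: idmul_subr.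
  rewrite /colength he; last by lia.
  rewrite hf; last by lia.
  congr (_ + _); rewrite /hilbert_poly -(big_mkord xpredT
    (fun i => (-1) ^+ i * f i * ('C(n + d - 1 - i, d - 1 - i))%:Z)).
  rewrite -(big_mkord xpredT
    (fun i => (-1) ^+ i * f i * ('C(n.+1 + d.-1 - 1 - i, d.-1 - i))%:Z)).
  rewrite prednK; last exact: ltnW.
  by apply: eq_bigr => i _; congr (_ * ('C(_, _))%:Z); lia.
have [e0J [n0 sumV]] := multiplicity_drop_length noeth mmax M_ideal M0 xM xreg xsup'
  mM (ltac:(by rewrite sx Kd)) M_red d0 hM.
rewrite sx Kd in e0J.
have mJM n : mprimary m (idmul J (M n)) by exact: mprimary_idmul.
have subI n : idmul J (M n) `<=` M n.+1 `&` last_part x M n.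
  by have := @idmul_sub_inter _ x M M_ideal xM d0 n; rewrite sx Kd.
have subJ n : last_part x M n `<=` J.
  by have := @last_part_sub _ x M d0 n; rewrite sx Kd.
have mI n : mprimary m (M n.+1 `&` last_part x M n).
  by apply: mprimary_sup (@subI n) (mJM n); apply: idealI => //; exact: ideal_last_part.
(* The index is shifted: [v n] and [w n] belong to M_(n+1). *)
pose v n := drop_length x M n.
pose w n := colength (idmul J (M n)) - colength (M n.+1).
have vw n : v n <= w n.
  rewrite /v /w /drop_length lerD2r; apply: (colength_mono noeth mmax) => //.
  by case: (mI n).
have v0 n : 0 <= v n.
  rewrite subr_ge0.
  exact: (colength_mono noeth mmax (M_ideal _) (mI n) (@subIsetl _ _ _)).
have vw_eq n : M n.+1 `&` J `<=` idmul J (M n) -> v n = w n.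
  move=> h; rewrite /v /w /drop_length; congr (colength _ - _).
  rewrite eqEsubset; split=> //; apply: subset_trans h.
  by apply: setIS.
have vw0 : v 0%N = w 0%N.
  by apply: vw_eq; rewrite M0 idmulT //; exact: subIsetr.
have vw1 : v 1%N = w 1%N.
  by apply: vw_eq; rewrite M1 M2 setIC JI12.
have w0E : w 0%N = colength J - colength I1 by rewrite /w M0 M1 idmulT.
have w1E : w 1%N = colength J + d%:Z * colength I1 - colength (idmul I1 I2).
  rewrite /w M1 M2; congr (_ - _).
  have := @colength_part_idmul _ m x I1 noeth mmax xreg mI1.
  by rewrite sx Kd => ->.
have sum2 (u : nat -> int) T : \sum_(i < T.+2) u i = u 0%N + u 1%N + \sum_(i < T) u i.+2.
  by rewrite !big_ord_recl addrA; congr (_ + _); apply: eq_bigr.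
have lenI2 : (idlength I2 (idmul I1 I2))%:Z = colength (idmul I1 I2) - colength I2.
  by apply: (idlengthE noeth mmax) => //; [exact: mprimary_idmul|exact: idmul_subr].
have f0E T : (n0 <= T)%N -> f 0%N = e 0%N + e 1%N - \sum_(i < T) v i.
  by move=> /sumV ->; ring.
have eqA := initial_regular_all M_ideal M0 xM xreg xsup' d0.
have eqB := initial_regular_but_last M_ideal M0 xM xreg xsup' d0.
rewrite !sx Kd in eqA eqB.
have xsupd k : (k < d)%N -> exists n0, forall n a, (n0 <= n)%N ->
    filt x M k n.+1 (a * x`_k) -> filt x M k n a by move=> kd; apply: xsup'; rewrite sx.
have CME := graded_cohen_macaulayE M_ideal M_decr xM xsupd M1p M0.
have DE := @graded_depthE _ _ _ _ _ M_ideal M_decr xM xsupd M1p M0 d.-1.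
split.
- move=> upper.
  (* An exact formula: the inequality is v >= 0, and equality means that all later v vanish. *)
  have upperE T : (n0 <= T)%N -> f 0%N = upper - \sum_(i < T) v i.+2.
    move=> hT; rewrite (f0E T.+2) ?(leqW (leqW hT)) // sum2 vw0 vw1 w0E w1E.
    by rewrite /upper lenI2 -/(colength I2) -/(colength I1) e0J; ring.
  split; first by rewrite (upperE n0) // gerBl; apply: sumr_ge0.
  split=> [fE|[CM MJ]].
    have vz : forall n, v n.+2 = 0.
      apply: (@sumr_ord_eq0 (fun n => v n.+2) n0) => // T /upperE.
      by rewrite fE -[LHS]addr0 => /addrI/esym/eqP; rewrite oppr_eq0 => /eqP.
    have Msub n : M n.+3 `<=` last_part x M n.+2.
      have /eqP := vz n; rewrite subr_eq0 => /eqP.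
      move=> /(colength_inj noeth mmax (M_ideal _) (mI _) (@subIsetl _ _ _)) <-.
      exact: subIsetr.
    split.
      (* The first two degrees hold by J M_0 = J and by [JI12]; the vanishing of v gives all
         others. *)
      apply/CME/eqA => -[|[|n]].
      - move=> a [Ja _]; have [|_ //] := subI 0%N a.
        by rewrite M0 idmulT.
      - by rewrite M2 JI12 -M1 => a /subI[].
      - by apply: (subset_trans (@subIsetr _ _ _)).
    move=> [|[|n]] // _; rewrite eqEsubset; split; last exact: (idadd_subr (M_ideal n.+3)).
    apply: (idadd_sub iJ) => //; exact: (subset_trans (@Msub n) (@subJ n.+2)).
  have vz n : v n.+2 = 0.
    have MsJ : M n.+3 `<=` J by rewrite -(MJ n.+2) //; exact: (idadd_subl iJ).
    rewrite /v /drop_length (_ : _ `&` _ = M n.+3) ?subrr //.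
    rewrite eqEsubset; split; first exact: subIsetl.
    move=> a Ma; split=> //; apply: (eqA.2 (CME.1 CM)); split=> //; exact: MsJ.
  by rewrite (upperE n0) // big1 ?subr0 // => i _; exact: vz.
- have wJ n : (2 <= n)%N -> (idlength (idmul I1 (idexp I2 n))
      (idmul J (idmul I1 (idexp I2 n.-1))))%:Z = w n.
    case: n => [|[|n]] // _; apply: (idlengthE noeth mmax (M_ideal n.+3) (mJM n.+2)).
    by move=> a /subI[].
  (* This gives the sum over all n >= 2 finite support, so that it equals a finite partial sum. *)
  have [n1 wz] : exists n1, forall n, (n1 <= n)%N -> w n = 0.
    have [n1 h] := M_red; exists n1 => n /h; rewrite sx Kd => MJ.
    rewrite /w (_ : idmul J (M n) = M n.+1) ?subrr // eqEsubset; split=> //.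
    by move=> a /subI[].
  have w1len : (idlength (idmul I1 I2) (idmul J I1))%:Z = w 1%N.
    rewrite /w M2 M1; apply: (idlengthE noeth mmax); first exact: ideal_idmul.
      exact: mprimary_idmul.
    by rewrite -JI12; exact: subIsetr.
  have sumE T : (n1 <= T)%N -> \sum_(n \in [set n : nat | (2 <= n)%N])
      (idlength (idmul I1 (idexp I2 n)) (idmul J (idmul I1 (idexp I2 n.-1))))%:Z =
      \sum_(i < T) w i.+2.
    move=> hT; rewrite (@fsbig_tail2 _ T).
      by apply: eq_bigr => i _; rewrite wJ.
    by move=> n hn; rewrite wJ ?wz //; lia.
  move=> lower.
  (* The defect is a sum of nonnegative terms w - v, so equality forces v = w in every degree. *)
  have lowerE T : (n0 <= T)%N -> (n1 <= T)%N ->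
      f 0%N = lower + \sum_(i < T.+2) (w i - v i).
    move=> h0 h1; rewrite (f0E T.+2) ?(leqW (leqW h0)) //.
    have -> : \sum_(i < T.+2) (w i - v i) = \sum_(i < T.+2) w i - \sum_(i < T.+2) v i.
      exact: sumrB.
    rewrite (sum2 w).
    rewrite /lower (sumE T h1) w1len w0E -/(colength I1) e0J; ring.
  have vw' n : 0 <= w n - v n by rewrite subr_ge0.
  split.
    by rewrite (lowerE (n0 + n1)%N) ?leq_addr ?leq_addl // lerDl; apply: sumr_ge0.
  rewrite subn1 DE ?leq_pred //; last by rewrite prednK //; exact: ltnW.
  rewrite -eqB //; split=> [fE n|h].
    have vwE : forall n, w n - v n = 0.
      apply: (@sumr_ord_eq0 _ (n0 + n1).+2) => // -[|[|T]] // hT.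
      have := lowerE T (ltac:(lia)) (ltac:(lia)).
      by rewrite fE -[LHS]addr0 => /addrI/esym.
    have /eqP := vwE n; rewrite subr_eq0 => /eqP/addIr wv.
    by apply/esym/(colength_inj noeth mmax _ (mJM n) (@subI n) wv); case: (mI n).
  rewrite (lowerE (n0 + n1)%N) ?leq_addr ?leq_addl // big1 ?addr0 // => i _.
  by rewrite /w /v /drop_length h subrr.
Qed.
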